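(* Let $\ell>0$ and let $\nu(z)=e^{\ell(z+z^{-1})/2}H(z)$, where $H$ is an entire function and $\nu$ is a positive weight on $\mathbb T$. Then, for every $n\in\mathbb N$, the corresponding structure matrix $M_n$ is a holomorphic function in $\mathbb C\setminus\{0\}$ (after holomorphic extension across $\mathbb T$) with a pole of order $2$ at $z=0$.
   Context: $\mathbb N=\{1,2,\dots\}$, $\mathbb T=\{|z|=1\}$ (counterclockwise), $d\mu(z)=\frac{\nu(z)}{\mathrm i z}dz$ is a positive measure on $\mathbb T$. $\Phi_n$ is the monic polynomial of degree $n$ with $\int_{\mathbb T}\Phi_n\overline{\Phi_m}\,d\mu=\kappa_n^{-2}\delta_{n,m}$, $\kappa_n>0$; $\Phi_n^*(z)=z^n\overline{\Phi_n(1/\bar z)}$; $b_n=2\pi\kappa_n^2$. For $z\notin\mathbb T$, $$G_n(z)=\frac1{2\pi \mathrm i}\int_{\mathbb T}\frac{\Phi_n(t)}{t-z}\frac{\nu(t)}{t^n}dt,\quad G_{n-1}^*(z)=\frac1{2\pi \mathrm i}\int_{\mathbb T}\frac{\Phi_{n-1}^*(t)}{t-z}\frac{\nu(t)}{t^n}dt,\quad Y_n=\begin{bmatrix}\Phi_n&G_n\\-b_{n-1}\Phi_{n-1}^*&-b_{n-1}G_{n-1}^*\end{bmatrix}\quad(n\in\mathbb N).$$ $C_n(z)=\operatorname{diag}\big(z^{-n/2}\nu(z)^{1/2},\,z^{n/2}\nu(z)^{-1/2}\big)$, $Z_n=Y_nC_n$, and the structure matrix is $M_n=Z_n'Z_n^{-1}=Y_n'Y_n^{-1}+Y_nC_n'C_n^{-1}Y_n^{-1}$.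 Local analytic branches are used for the powers; $C_n'C_n^{-1}=\big(-\frac n{2z}+\frac{\nu'(z)}{2\nu(z)}\big)\operatorname{diag}(1,-1)$ and $M_n$ do not depend on the branches. A pole of order $2$ of a matrix function means that $z^2M_n(z)$ has a nonzero finite (matrix) limit as $z\to0$. *)

(* Defs.v *)
From HB Require Import structures.
From mathcomp Require Import all_boot all_order all_algebra.
From mathcomp Require Import complex.
From mathcomp Require Import all_classical all_reals all_analysis.

Set Implicit Arguments.
Unset Strict Implicit.
Unset Printing Implicit Defensive.

Import Order.TTheory GRing.Theory Num.Theory.
Import numFieldNormedType.Exports.

Local Open Scope classical_set_scope.
Local Open Scope ring_scope.

(* The topology and the normed-module structure that MathComp-Analysis puts on
   a numFieldType are found through the structure, not through the bare type
   R[i]. Here [derivable f z 1] and [derive1 f z] are complex differentiability and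
   the complex derivative, and [0 < z] means that z is real and positive. *)
Notation "'C_of' R" := (complex R : numClosedFieldType)
  (at level 10, R at level 9, only parsing).

Section OPUC.
Variable R : realType.
Local Notation C := (C_of R).

Implicit Types (z w t : C) (n : nat).

Definition cplx (x : R) : C := Complex x 0.

Definition cexp (z : C) : C :=
  cplx (expR (complex.Re z)) *
  Complex (cos (complex.Im z)) (sin (complex.Im z)).

Definition expi (theta : R) : C := Complex (cos theta) (sin theta).

Definition on_circle (z : C) : Prop := `|z| = 1.

Definition cintegral (a b : R) (g : R -> C) : C :=
  Complex (\int[lebesgue_measure]_(x in `[a, b]) complex.Re (g x))
          (\int[lebesgue_measure]_(x in `[a, b]) complex.Im (g x)).

(* Counterclockwise contour integral over the unit circle, with the
   parametrization t = e^(i theta), dt = i e^(i theta) d theta. *)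
Definition circle_integral (f : C -> C) : C :=
  cintegral 0 (2 * pi) (fun theta => f (expi theta) * ('i%C * expi theta)).

Definition entire (f : C -> C) : Prop := forall z, derivable f z 1.

Definition weight (l : R) (H : C -> C) (z : C) : C :=
  cexp (cplx l * (z + z^-1) / 2) * H z.

Definition mu_integral (nu f : C -> C) : C :=
  circle_integral (fun z => f z * (nu z / ('i%C * z))).

Definition is_monic_OPUC (nu : C -> C) (Phi : nat -> {poly C})
    (kappa : nat -> R) : Prop :=
  [/\ forall n, Phi n \is monic /\ size (Phi n) = n.+1,
      forall n, 0 < kappa n
    & forall n m, mu_integral nu (fun z => (Phi n).[z] * ((Phi m).[z])^* ) =
                  if n == m then cplx (kappa n ^- 2) else 0].

(* The reversed polynomial, by its formula on C \ {0}. Since 0^-1 = 0 the value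
   at z = 0 is not the one of the polynomial; it is never used below, because
   the structure matrix is considered only at nonzero points. *)
Definition reversed n (p : {poly C}) (z : C) : C := z ^+ n * (p.[(z^* )^-1])^*.

Definition bcoef (kappa : nat -> R) n : C := cplx (2 * pi * kappa n ^+ 2).

Definition G_fun (nu : C -> C) (Phi : nat -> {poly C}) n (z : C) : C :=
  (cplx (2 * pi) * 'i%C)^-1 *
  circle_integral (fun t => (Phi n).[t] / (t - z) * (nu t / t ^+ n)).

(* This is G^*_{n-1}: the polynomial has index n - 1, the power of t is n. *)
Definition Gstar_pred (nu : C -> C) (Phi : nat -> {poly C}) n (z : C) : C :=
  (cplx (2 * pi) * 'i%C)^-1 *
  circle_integral
    (fun t => reversed n.-1 (Phi n.-1) t / (t - z) * (nu t / t ^+ n)).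

Definition mx2 (a b c d : C) : 'M[C]_2 :=
  \matrix_(i < 2, j < 2)
    if i == 0 then (if j == 0 then a else b) else (if j == 0 then c else d).

Definition Y_mx (nu : C -> C) (Phi : nat -> {poly C}) (kappa : nat -> R)
    n (z : C) : 'M[C]_2 :=
  mx2 (Phi n).[z]
      (G_fun nu Phi n z)
      (- bcoef kappa n.-1 * reversed n.-1 (Phi n.-1) z)
      (- bcoef kappa n.-1 * Gstar_pred nu Phi n z).

(* s is an analytic branch of f^(1/2) in a neighbourhood of z. *)
Definition sqrt_branch (f s : C -> C) (z : C) : Prop :=
  \forall w \near z, derivable s w 1 /\ s w ^+ 2 = f w.

(* s stands for z^(1/2) and r for nu(z)^(1/2). *)
Definition C_mx n (s r : C -> C) (z : C) : 'M[C]_2 :=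
  mx2 (s z ^- n * r z) 0 0 (s z ^+ n * (r z)^-1).

Definition Z_mx (nu : C -> C) (Phi : nat -> {poly C}) (kappa : nat -> R)
    n (s r : C -> C) (z : C) : 'M[C]_2 :=
  Y_mx nu Phi kappa n z *m C_mx n s r z.

(* M is the value at z of the structure matrix Z_n' Z_n^(-1): local analytic
   branches exist at z, Z_n(z) is invertible, and M is obtained from every
   choice of the branches. *)
Definition is_structure_matrix (nu : C -> C) (Phi : nat -> {poly C})
    (kappa : nat -> R) n (z : C) (M : 'M[C]_2) : Prop :=
  (exists s r : C -> C, sqrt_branch id s z /\ sqrt_branch nu r z) /\
  (forall s r : C -> C, sqrt_branch id s z -> sqrt_branch nu r z ->
    let Z := Z_mx nu Phi kappa n s r in
    [/\ derivable Z z 1, Z z \in unitmx & M = derive1 Z z *m invmx (Z z)]).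

Definition pole_order2_at0 (M : C -> 'M[C]_2) : Prop :=
  exists2 L : 'M[C]_2, L != 0 & (z ^+ 2 *: M z) @[z --> (0 : C)^'] --> L.

End OPUC.

(* Main.v *)
(* An entire function that is real on the unit circle is constant: by Goursat's
   theorem applied to [f o exp] on rectangles, the mean of [z^m f(z)] over
   [|z| = r] is independent of [r] for every integer [m]; it vanishes for [m > 0]
   (let [r] tend to 0), hence, by conjugation on [|z| = 1], for [m < 0] too, and
   the Cauchy integral of [f], expanded in powers of [z0 / z], reduces to [f 0].
   So [H] is a positive constant and [z^2 nu' = l/2 (z^2 - 1) nu].

   Put [K(z) = 1/(2 pi i) int nu(t) t^-n / (t - z) dt]. Each row of [Y_n] is
   [(p, p K + r)] with polynomials [p], [r], and integrating by parts gives
   [z^2 K' = s K + e] with polynomials [s], [e]. Hence [z^2 Z_n' C_n^-1 = Q B] and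
   [Y_n = P B] with polynomial matrices [P], [Q] and [B = [1 K; 0 1]]. The
   polynomial [det P = det Y_n] tends to 1 at infinity by orthogonality, so it is
   1 and [z^2 M_n = Q adj(P)] is a polynomial matrix. If it vanished at 0, so
   would the first column of [P], as that of [Q] is [-l/4] times it at 0. *)
Require Import Defs.
From HB Require Import structures.
From mathcomp Require Import all_boot all_order all_algebra.
From mathcomp Require Import complex.
From mathcomp Require Import all_classical all_reals all_analysis.
From mathcomp Require Import ring lra.

Set Implicit Arguments.
Unset Strict Implicit.
Unset Printing Implicit Defensive.

Import Order.TTheory GRing.Theory Num.Theory.
Import numFieldNormedType.Exports.

Local Open Scope classical_set_scope.
Local Open Scope ring_scope.

(** * Complex numbers as a normed plane *)

(** K is transcendental and is a different analytic function inside and outside T, but nothing else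
    in the factorization depends on the side: p and s are explicit, and r and e are built from
    moments taken over the whole circle. The common factor B cancels in M_n = z^-2 (Q B) (P B)^-1,
    so a single rational formula holds on both sides of T; this formula is the extension. B can be
    split off from z^2 Z_n' C_n^-1 because s is exactly twice the upper diagonal entry of z^2 C_n'
    C_n^-1: the two contributions to the coefficient of K in the second column then add up to the
    entry in the first column. Composition with exp turns circles about 0 into vertical segments and
    annuli into rectangles, so that Goursat's theorem is needed for rectangles only. The singularity
    at z0 in Cauchy's formula is not shown to be removable in the analytic sense: continuity across
    a single vertical line is enough. *)

Section Modulus.
Variable R : realType.
Local Notation C := (C_of R).
Implicit Types (z w : C) (x y : R).

(** The norm of C takes its values in C, where the order is partial; a real-valued copy gives access
    to a total order, [lra] and real error bounds. *)
Definition modulus z : R := complex.Re `|z|.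

Lemma normc_modulus z : `|z| = cplx (modulus z).
Proof. by rewrite /modulus /cplx; case: z => a b. Qed.

Lemma cplxD x y : cplx (x + y) = cplx x + cplx y :> C.
Proof. exact: (rmorphD (real_complex R)). Qed.

Lemma cplxB x y : cplx (x - y) = cplx x - cplx y :> C.
Proof. exact: (rmorphB (real_complex R)). Qed.

Lemma cplxM x y : cplx (x * y) = cplx x * cplx y :> C.
Proof. exact: (rmorphM (real_complex R)). Qed.

Lemma cplxV x : cplx x^-1 = (cplx x)^-1 :> C.
Proof. exact: (fmorphV (real_complex R)). Qed.

Lemma cplx_inj : injective (@cplx R).
Proof. by move=> x y []. Qed.

Lemma cplx1 : cplx 1 = 1 :> C. Proof. by []. Qed.

Lemma cplx0 : cplx 0 = 0 :> C. Proof. by []. Qed.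

Lemma cplx_nat n : cplx n%:R = n%:R :> C.
Proof. exact: (rmorph_nat (real_complex R)). Qed.

Lemma ler_cplx x y : (cplx x <= cplx y :> C) = (x <= y).
Proof. exact: lecR. Qed.

Lemma ltr_cplx x y : (cplx x < cplx y :> C) = (x < y).
Proof. exact: ltcR. Qed.

Lemma cplx_eq0 x : (cplx x == 0 :> C) = (x == 0).
Proof. by rewrite -cplx0 eq_complex /= eqxx andbT. Qed.

Lemma gt0_cplx (e : C) : 0 < e -> exists2 r : R, 0 < r & e = cplx r.
Proof.
case: e => a b; rewrite ltcE /= => /andP[/eqP -> a0].
by exists a.
Qed.

Lemma modulusM z w : modulus (z * w) = modulus z * modulus w.
Proof. by apply: cplx_inj; rewrite cplxM -!normc_modulus normrM. Qed.

Lemma modulus_ge0 z : 0 <= modulus z.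
Proof. by rewrite -ler_cplx -normc_modulus normr_ge0. Qed.

Lemma modulusN z : modulus (- z) = modulus z.
Proof. by rewrite /modulus normrN. Qed.

Lemma modulusB z w : modulus (z - w) = modulus (w - z).
Proof. by rewrite /modulus distrC. Qed.

Lemma modulus_eq0 z : (modulus z == 0) = (z == 0).
Proof. by rewrite -cplx_eq0 -normc_modulus normr_eq0. Qed.

Lemma modulus_gt0 z : (0 < modulus z) = (z != 0).
Proof. by rewrite lt_def modulus_eq0 modulus_ge0 andbT. Qed.

Lemma modulus0 : modulus 0 = 0.
Proof. by apply/eqP; rewrite modulus_eq0. Qed.

Lemma modulus1 : modulus 1 = 1.
Proof. by rewrite /modulus normr1. Qed.

Lemma modulusV z : modulus z^-1 = (modulus z)^-1.
Proof.
by apply: cplx_inj; rewrite cplxV -!normc_modulus normfV.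
Qed.

Lemma modulusX z n : modulus (z ^+ n) = modulus z ^+ n.
Proof.
by elim: n => [|n IH]; rewrite ?expr0 ?modulus1 // !exprS modulusM IH.
Qed.

Lemma le_modulusD z w : modulus (z + w) <= modulus z + modulus w.
Proof. by rewrite -ler_cplx cplxD -!normc_modulus ler_normD. Qed.

Lemma le_modulusB z w : modulus (z - w) <= modulus z + modulus w.
Proof. by rewrite -(modulusN w) le_modulusD. Qed.

Lemma le_modulus_dist z w : modulus z - modulus w <= modulus (z - w).
Proof. by rewrite lerBlDr -{1}(subrK w z) le_modulusD. Qed.

Lemma modulus_cplx x : modulus (cplx x) = `|x|.
Proof. by rewrite /modulus /cplx normc_def /= expr0n addr0 sqrtr_sqr. Qed.

Lemma modulus_i : modulus 'i%C = 1.
Proof. by rewrite /modulus normc_def /= expr0n add0r expr1n sqrtr1. Qed.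

Lemma le_Re_modulus z : `|complex.Re z| <= modulus z.
Proof.
by rewrite -ler_cplx -normc_modulus; apply: normc_ge_Re.
Qed.

Lemma le_Im_modulus z : `|complex.Im z| <= modulus z.
Proof.
have -> : complex.Im z = - complex.Re (z * 'i%C) by rewrite ReiNIm opprK.
by rewrite normrN (le_trans (le_Re_modulus _)) // modulusM modulus_i mulr1.
Qed.

Lemma le_modulus_ReIm z : modulus z <= `|complex.Re z| + `|complex.Im z|.
Proof.
rewrite {1}(complexE z) (le_trans (le_modulusD _ _)) // modulusM modulus_i mul1r.
by rewrite -[X in modulus X + _]/(cplx _) -[X in _ + modulus X]/(cplx _) !modulus_cplx.
Qed.

Lemma cReD z w : complex.Re (z + w) = complex.Re z + complex.Re w.
Proof. by case: z w => a b []. Qed.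

Lemma cImD z w : complex.Im (z + w) = complex.Im z + complex.Im w.
Proof. by case: z w => a b []. Qed.

Lemma cReN z : complex.Re (- z) = - complex.Re z.
Proof. by case: z. Qed.

Lemma cImN z : complex.Im (- z) = - complex.Im z.
Proof. by case: z. Qed.

Lemma cReM z w : complex.Re (z * w) =
  complex.Re z * complex.Re w - complex.Im z * complex.Im w.
Proof. by case: z w => a b []. Qed.

Lemma cImM z w : complex.Im (z * w) =
  complex.Re z * complex.Im w + complex.Im z * complex.Re w.
Proof. by case: z w => a b []. Qed.

Lemma cRe_conj z : complex.Re z^* = complex.Re z.
Proof. by case: z. Qed.

Lemma cIm_conj z : complex.Im z^* = - complex.Im z.
Proof. by case: z. Qed.

Lemma complexP z w : complex.Re z = complex.Re w ->
  complex.Im z = complex.Im w -> z = w.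
Proof. by case: z w => a b [c d] /= -> ->. Qed.

Lemma Re_cartesian x y : complex.Re (cplx x + 'i%C * cplx y) = x.
Proof. by rewrite cReD cReM /= !(mul0r, mulr0, subr0, addr0). Qed.

Lemma Im_cartesian x y : complex.Im (cplx x + 'i%C * cplx y) = y.
Proof. by rewrite cImD cImM /= !(mul0r, mul1r, addr0, add0r). Qed.

End Modulus.

Section Topology.
Variable R : realType.
Local Notation C := (C_of R).
Implicit Types (z w : C) (x y : R).

(** Positive elements of C are real by [gt0_cplx], so the complex radii of the normed structure can
    be traded for real ones. *)
Lemma cvg_modulusP {T : Type} {F : set_system T} {FF : Filter F} (f : T -> C) z :
  f @ F --> z <->
  (forall e : R, 0 < e -> \forall x \near F, modulus (f x - z) <= e).
Proof.
split=> [/cvgrPdist_le fz e e0|fz].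
  have ce0 : 0 < cplx e :> C by rewrite -cplx0 ltr_cplx.
  near=> x; rewrite -ler_cplx -normc_modulus distrC; near: x; exact: fz.
apply/cvgrPdist_le => _ /gt0_cplx[e e0 ->]; near=> x.
rewrite distrC normc_modulus ler_cplx; near: x; exact: fz.
Unshelve. all: by end_near. Qed.

Lemma nbhs_modulusP z (P : set C) :
  nbhs z P <-> exists2 d : R, 0 < d & forall w, modulus (w - z) < d -> P w.
Proof.
split=> [/nbhs_ballP[_ /gt0_cplx[d d0 ->] dP]|[d d0 dP]].
  exists d => // w wz; apply: dP; rewrite -ball_normE /ball_ /=.
  by rewrite distrC normc_modulus ltr_cplx.
apply/nbhs_ballP; exists (cplx d) => /=; first by rewrite -cplx0 ltr_cplx.
move=> w; rewrite -ball_normE /ball_ /= distrC normc_modulus ltr_cplx.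
exact: dP.
Qed.

Lemma dnbhs_modulusP z (P : set C) :
  z^' P <-> exists2 d : R, 0 < d &
    forall w, modulus (w - z) < d -> w != z -> P w.
Proof. by split=> [/nbhs_modulusP|H]; [|apply/nbhs_modulusP]. Qed.

Lemma continuous_modulusP (f : C -> C) z :
  {for z, continuous f} <-> forall e : R, 0 < e -> exists2 d : R, 0 < d &
    forall w, modulus (w - z) < d -> modulus (f w - f z) <= e.
Proof.
apply: (iff_trans (@cvg_modulusP _ _ (nbhs_filter z) f (f z))).
by split=> H e e0; [apply/nbhs_modulusP|apply/nbhs_modulusP]; exact: H.
Qed.

Lemma cvg_componentsP {T : Type} {F : set_system T} {FF : Filter F} (f : T -> C) z :
  f @ F --> z <->
  (@complex.Re R \o f) @ F --> complex.Re z /\ (@complex.Im R \o f) @ F --> complex.Im z.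
Proof.
split=> [/cvg_modulusP fz|[/cvgrPdist_le fr /cvgrPdist_le fi]].
  split; apply/cvgrPdist_le => e e0; near=> x => /=.
    rewrite distrC -cReN -cReD (le_trans (le_Re_modulus _)) //.
    by near: x; exact: fz.
  rewrite distrC -cImN -cImD (le_trans (le_Im_modulus _)) //.
  by near: x; exact: fz.
apply/cvg_modulusP => e e0; have e20 : 0 < e / 2 by rewrite divr_gt0.
near=> x; rewrite (le_trans (le_modulus_ReIm _)) // (splitr e).
rewrite cReD cImD cReN cImN !(distrC (_ (f x))) lerD //.
  by near: x; exact: fr.
by near: x; exact: fi.
Unshelve. all: by end_near. Qed.

Lemma continuous_componentsP {T : topologicalType} (f : T -> C) :
  continuous f <->
  continuous (@complex.Re R \o f) /\ continuous (@complex.Im R \o f).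
Proof.
split=> [fc|[fr fi] x].
  by split=> x; have /cvg_componentsP[] := fc x.
by apply/cvg_componentsP; split; [exact: fr|exact: fi].
Qed.

Lemma continuous_cplx : continuous (@cplx R : R -> C).
Proof. by apply/continuous_componentsP; split=> x; [exact: cvg_id|exact: cvg_cst]. Qed.

Lemma continuous_expi : continuous (@expi R : R -> C).
Proof.
apply/continuous_componentsP.
by split; [exact: continuous_cos|exact: continuous_sin].
Qed.

Lemma continuous_cexp : continuous (@cexp R : C -> C).
Proof.
have idc : continuous (fun z : C => z) by move=> z; exact: cvg_id.
have /continuous_componentsP[cr ci] := idc.
move=> z; apply: (@continuousM C C
  (fun z => cplx (expR (complex.Re z))) (fun z => expi (complex.Im z)) z).
  have h1 : {for z, continuous (fun z : C => expR (complex.Re z))}.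
    exact: (continuous_comp (cr z) (@continuous_expR R _)).
  exact: (continuous_comp h1 (@continuous_cplx _)).
exact: (continuous_comp (ci z) (@continuous_expi _)).
Qed.

(** A form without difference quotient: no division and no excluded point, which makes the chain
    rule a plain estimate. *)
Definition cderiv (f : C -> C) z (d : C) := forall e : R, 0 < e ->
  exists2 r : R, 0 < r & forall w, modulus (w - z) < r ->
    modulus (f w - f z - d * (w - z)) <= e * modulus (w - z).

(** The argument is real and the value complex, so the increment is embedded by [cplx];
    [rderiv_components] links this to the two real components. *)
Definition rderiv (g : R -> C) x (d : C) := forall e : R, 0 < e ->
  exists2 r : R, 0 < r & forall y, `|y - x| < r ->
    modulus (g y - g x - d * cplx (y - x)) <= e * `|y - x|.

Lemma cderivP (f : C -> C) z d : is_derive z 1 f d <-> cderiv f z d.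
Proof.
have cvgE : h^-1 *: (f (h *: 1 + z) - f z) @[h --> (0 : C)^'] --> d <-> cderiv f z d.
  apply: (iff_trans (@cvg_modulusP _ _ (dnbhs_filter _) _ d)); split=> H e e0.
    have /dnbhs_modulusP[r r0 rH] := H _ e0; exists r => // w wz.
    have [->|wNz] := eqVneq w z.
      by rewrite !subrr mulr0 subr0 modulus0 mulr0.
    have wz0 : w - z != 0 by rewrite subr_eq0.
    have := rH (w - z); rewrite subr0 => /(_ wz wz0).
    rewrite /GRing.scale /= mulr1 subrK => le_e.
    have -> : f w - f z - d * (w - z) =
      ((w - z)^-1 * (f w - f z) - d) * (w - z) by field.
    by rewrite modulusM ler_wpM2r // modulus_ge0.
  have [r r0 rH] := H _ e0; apply/dnbhs_modulusP; exists r => // w.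
  rewrite subr0 => wr w0; have := rH (w + z); rewrite addrK => /(_ wr).
  rewrite /GRing.scale /= mulr1 => le_e.
  have -> : w^-1 * (f (w + z) - f z) - d =
    (f (w + z) - f z - d * w) * w^-1 by field.
  by rewrite modulusM modulusV ler_pdivrMr // modulus_gt0.
split=> [[fd fE]|/cvgE fd]; first by apply/cvgE; rewrite -fE; exact: fd.
apply: DeriveDef; first by apply/cvg_ex; exists d.
exact: cvg_lim fd.
Qed.

(** The inner function enters only through its value [w] and the increment [h], so one estimate
    serves curves ([rderiv_comp]) and complex functions ([cderiv_comp]). *)
Lemma cderiv_chain (f : C -> C) z d d' : cderiv f z d ->
  forall e : R, 0 < e -> exists2 k : R, 0 < k & exists2 r : R, 0 < r &
    forall w h, modulus h < r -> modulus (w - z - d' * h) <= k * modulus h ->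
      modulus (f w - f z - d * d' * h) <= e * modulus h.
Proof.
move=> fd e e0.
set K := modulus d' + 1.
have K0 : 0 < K by rewrite ltr_wpDl // modulus_ge0.
have D0 : 0 < modulus d + 1 by rewrite ltr_wpDl // modulus_ge0.
have [r1 r10 r1P] := fd (e / (2 * K)) (divr_gt0 e0 (mulr_gt0 (ltr0Sn R 1) K0)).
(* The bound 1 gives |w - z| <= K |h|; the other bound keeps the inner error, multiplied by |d| + 1,
   below e/2 |h|. *)
exists (Num.min 1 (e / (2 * (modulus d + 1)))).
  by rewrite lt_min ltr01 divr_gt0 // mulr_gt0.
exists (r1 / K) => [|w h hr]; first by rewrite divr_gt0.
move: (modulus_ge0 h) hr => h0 hr gle.
have gle1 : modulus (w - z) <= K * modulus h.
  rewrite -[w - z](subrK (d' * h)).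
  rewrite (le_trans (le_modulusD _ _)) // modulusM.
  rewrite /K addrC mulrDl lerD2l (le_trans gle) // ler_wpM2r //.
  by rewrite ge_min lexx.
have gle2 : modulus (w - z - d' * h) <= e / (2 * (modulus d + 1)) * modulus h.
  by rewrite (le_trans gle) // ler_wpM2r // ge_min lexx orbT.
have gr1 : modulus (w - z) < r1.
  by rewrite (le_lt_trans gle1) // mulrC -ltr_pdivlMr.
have := r1P _ gr1 => fle.
have -> : f w - f z - d * d' * h =
  (f w - f z - d * (w - z)) + d * (w - z - d' * h) by ring.
rewrite (le_trans (le_modulusD _ _)) // [modulus (d * _)]modulusM.
have -> : e * modulus h = e / (2 * K) * (K * modulus h) +
    (modulus d + 1) * (e / (2 * (modulus d + 1)) * modulus h).
  by field; rewrite !gt_eqF.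
rewrite lerD //.
  rewrite (le_trans fle) // ler_wpM2l // divr_ge0 // ltW // mulr_gt0 //.
rewrite ler_pM ?modulus_ge0 //.
by rewrite lerDl.
Qed.

Lemma rderiv_comp (f : C -> C) (g : R -> C) x d d' :
  is_derive (g x) 1 f d -> rderiv g x d' -> rderiv (f \o g) x (d * d').
Proof.
move=> /cderivP fd gd e e0.
have [k k0 [r r0 rP]] := cderiv_chain d' fd e0; have [s s0 sP] := gd _ k0.
exists (Num.min r s) => [|y]; first by rewrite lt_min r0.
rewrite lt_min => /andP[yr ys]; rewrite -modulus_cplx.
by apply: rP; rewrite modulus_cplx //; exact: sP.
Qed.

Lemma rderiv_components (g : R -> C) x d : rderiv g x d <->
  is_derive x 1 (@complex.Re R \o g) (complex.Re d) /\
  is_derive x 1 (@complex.Im R \o g) (complex.Im d).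
Proof.
have dP (f : R -> R) (c : R) : is_derive x 1 f c <-> forall e : R, 0 < e ->
  exists2 r : R, 0 < r & forall y, `|y - x| < r ->
    `|f y - f x - c * (y - x)| <= e * `|y - x|.
  have cvgE : h^-1 *: (f (h *: 1 + x) - f x) @[h --> (0 : R)^'] --> c <->
      forall e : R, 0 < e -> exists2 r : R, 0 < r & forall y, `|y - x| < r ->
        `|f y - f x - c * (y - x)| <= e * `|y - x|.
    split=> [/cvgrPdist_le|] H.
      move=> e e0; have [r r0 rH] := H _ e0; exists r => // w wz.
      have [->|wNz] := eqVneq w x.
        by rewrite !subrr mulr0 subr0 normr0 mulr0.
      have wz0 : w - x != 0 by rewrite subr_eq0.
      have := rH (w - x); rewrite /ball_ /= sub0r normrN => /(_ wz wz0).
      rewrite /GRing.scale /= mulr1 subrK distrC => le_e.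
      have -> : f w - f x - c * (w - x) =
        ((w - x)^-1 * (f w - f x) - c) * (w - x) by field.
      by rewrite normrM ler_wpM2r.
    apply/cvgrPdist_le => e e0.
    have [r r0 rH] := H _ e0; exists r => // w.
    rewrite /ball_ /= sub0r normrN => wr w0; have := rH (w + x); rewrite addrK => /(_ wr).
    rewrite /GRing.scale /= mulr1 => le_e; rewrite distrC.
    have -> : w^-1 * (f (w + x) - f x) - c =
      (f (w + x) - f x - c * w) * w^-1 by field.
    by rewrite normrM normfV ler_pdivrMr // normr_gt0.
  split=> [[fd fE]|/cvgE fd]; first by apply/cvgE; rewrite -fE; exact: fd.
  apply: DeriveDef; first by apply/cvg_ex; exists c.
  exact: cvg_lim fd.
have reE y : complex.Re (g y - g x - d * cplx (y - x)) =
    complex.Re (g y) - complex.Re (g x) - complex.Re d * (y - x).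
  by rewrite !cReD !cReN cReM /= mulr0 subr0.
have imE y : complex.Im (g y - g x - d * cplx (y - x)) =
    complex.Im (g y) - complex.Im (g x) - complex.Im d * (y - x).
  by rewrite !cImD !cImN cImM /= mulr0 add0r.
split=> [H|[/dP Hr /dP Hi] e e0].
  split; apply/dP => e e0; have [r r0 rH] := H _ e0; exists r => // y yx.
    by rewrite -reE (le_trans (le_Re_modulus _)) // rH.
  by rewrite -imE (le_trans (le_Im_modulus _)) // rH.
have e20 : 0 < e / 2 by rewrite divr_gt0.
have [r r0 rP] := Hr _ e20; have [s s0 sP] := Hi _ e20.
exists (Num.min r s); first by rewrite lt_min r0.
move=> y; rewrite lt_min => /andP[yr ys].
rewrite (le_trans (le_modulus_ReIm _)) // reE imE (splitr e) mulrDl lerD //.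
  exact: rP.
exact: sP.
Qed.

Lemma rderiv_expi x : rderiv (@expi R) x ('i%C * expi x).
Proof.
by apply/rderiv_components; split; rewrite ?cReM ?cImM /= ?mul0r ?mul1r ?sub0r ?add0r;
  [exact: is_derive_cos|exact: is_derive_sin].
Qed.

Lemma rderiv_line (a : C) (b : C) x : rderiv (fun x => a + b * cplx x) x b.
Proof.
move=> e e0; exists 1 => // y _.
rewrite cplxB (_ : _ - _ = 0); last by ring.
by rewrite modulus0 mulr_ge0 // ltW.
Qed.

End Topology.

Section ComplexDerivative.
Variable R : realType.
Local Notation C := (C_of R).
Implicit Types (f g : C -> C) (z d e : C).

Lemma is_derive_continuous f z d : is_derive z 1 f d -> {for z, continuous f}.
Proof. by move=> fd; apply/differentiable_continuous/derivable1_diffP; case: fd. Qed.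

Lemma cderiv_id z : is_derive z 1 (fun w : C => w) 1.
Proof. exact: is_derive_id. Qed.

Lemma cderiv_cst (k : C) z : is_derive z 1 (fun=> k) 0.
Proof. exact: is_derive_cst. Qed.

Lemma cderivD f g z d e : is_derive z 1 f d -> is_derive z 1 g e ->
  is_derive z 1 (fun w => f w + g w) (d + e).
Proof. by move=> fd gd; exact: is_deriveD. Qed.

Lemma cderivN f z d : is_derive z 1 f d -> is_derive z 1 (fun w => - f w) (- d).
Proof. by move=> fd; exact: is_deriveN. Qed.

Lemma cderivB f g z d e : is_derive z 1 f d -> is_derive z 1 g e ->
  is_derive z 1 (fun w => f w - g w) (d - e).
Proof. by move=> fd gd; apply: cderivD => //; exact: cderivN. Qed.

Lemma cderivM f g z d e : is_derive z 1 f d -> is_derive z 1 g e ->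
  is_derive z 1 (fun w => f w * g w) (d * g z + f z * e).
Proof.
move=> fd gd; apply: (is_derive_eq (is_deriveM fd gd)).
by rewrite /GRing.scale /= addrC [g z * d]mulrC.
Qed.

Lemma cderivV f z d : f z != 0 -> is_derive z 1 f d ->
  is_derive z 1 (fun w => (f w)^-1) (- d / f z ^+ 2).
Proof.
move=> f0 [fd <-]; apply: DeriveDef; first exact: derivableV.
by rewrite deriveV // /GRing.scale /= !mulNr mulrC.
Qed.

Lemma cderivX f z d n : is_derive z 1 f d ->
  is_derive z 1 (fun w => f w ^+ n) (n%:R * f z ^+ n.-1 * d).
Proof.
move=> fd; elim: n => [|n IH].
  by rewrite !mul0r; exact: cderiv_cst.
under eq_fun do rewrite exprS.
apply: is_derive_eq (cderivM fd IH) _ => /=; rewrite -natr1.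
case: n {IH} => [|n] /=; first by rewrite expr0; ring.
by rewrite exprS; ring.
Qed.

Lemma cderiv_horner (p : {poly C}) z : is_derive z 1 (horner p) p^`().[z].
Proof.
elim/poly_ind: p => [|p c IH].
  rewrite deriv0 horner0 (_ : horner 0 = fun=> 0); first exact: cderiv_cst.
  by apply: funext => w; rewrite horner0.
rewrite (_ : horner _ = fun w => p.[w] * w + c); last first.
  by apply: funext => w; rewrite hornerMXaddC.
apply: is_derive_eq (cderivD (cderivM IH (cderiv_id z)) (cderiv_cst c z)) _.
by rewrite derivD derivC derivM derivX !hornerE.
Qed.

Lemma cderiv_comp f g z d e : is_derive (g z) 1 f d -> is_derive z 1 g e ->
  is_derive z 1 (fun w => f (g w)) (d * e).
Proof.
move=> /cderivP fd /cderivP gd; apply/cderivP => r r0.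
have [k k0 [s s0 sP]] := cderiv_chain e fd r0; have [t t0 tP] := gd _ k0.
exists (Num.min s t) => [|w]; first by rewrite lt_min s0.
by rewrite lt_min => /andP[ws wt]; apply: sP => //; exact: tP.
Qed.

End ComplexDerivative.

(** * Integrals of continuous complex-valued paths *)

Section Integral.
Variable R : realType.
Local Notation C := (C_of R).
Local Notation mu := (@lebesgue_measure R).
Implicit Types (a b c x : R) (g h : R -> C).

Lemma continuous_integrable (f : R -> R) a b :
  continuous f -> mu.-integrable `[a, b] (EFin \o f).
Proof.
move=> fc; apply: continuous_compact_integrable; first exact: segment_compact.
exact: continuous_subspaceT.
Qed.

(* Wrapping continuity in an inductive predicate stops unification from
   unfolding the topologies when two different integrands are compared. *)
Variant cpath (g : R -> C) : Prop := CPath of continuous g.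

Lemma continuousRe g : cpath g -> continuous (fun x => complex.Re (g x)).
Proof. by case=> /continuous_componentsP[]. Qed.

Lemma continuousIm g : cpath g -> continuous (fun x => complex.Im (g x)).
Proof. by case=> /continuous_componentsP[]. Qed.

Lemma cpath_cst (k : C) : cpath (fun=> k).
Proof. by split=> x; exact: cvg_cst. Qed.

Lemma cpathD g h : cpath g -> cpath h -> cpath (fun x => g x + h x).
Proof. by move=> [gc] [hc]; split=> x; apply: cvgD; [exact: gc|exact: hc]. Qed.

Lemma cpathM g h : cpath g -> cpath h -> cpath (fun x => g x * h x).
Proof. by move=> [gc] [hc]; split=> x; apply: cvgM; [exact: gc|exact: hc]. Qed.

Lemma cpathN g : cpath g -> cpath (fun x => - g x).
Proof. by move=> [gc]; split=> x; apply: cvgN; exact: gc. Qed.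

Lemma cpathB g h : cpath g -> cpath h -> cpath (fun x => g x - h x).
Proof. by move=> gc hc; apply: cpathD gc (cpathN hc). Qed.

Lemma cpathV g : (forall x, g x != 0) -> cpath g -> cpath (fun x => (g x)^-1).
Proof. by move=> g0 [gc]; split=> x; apply: cvgV; [exact: g0|exact: gc]. Qed.

Lemma cpathX g n : cpath g -> cpath (fun x => g x ^+ n).
Proof.
move=> gc; elim: n => [|n IH]; first exact: cpath_cst.
by under eq_fun do rewrite exprS; exact: cpathM.
Qed.

Lemma cpath_comp (f : C -> C) g : (forall x, {for g x, continuous f}) ->
  cpath g -> cpath (fun x => f (g x)).
Proof.
by move=> fc [gc]; split=> x; apply: (continuous_comp (gc x)); exact: fc.
Qed.

Lemma cpath_horner (p : {poly C}) g : cpath g -> cpath (fun x => p.[g x]).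
Proof.
move=> gc; elim/poly_ind: p => [|p c IH].
  by under eq_fun do rewrite horner0; exact: cpath_cst.
under eq_fun do rewrite hornerMXaddC.
exact: cpathD (cpathM IH gc) (cpath_cst c).
Qed.

Lemma cpath_conj g : cpath g -> cpath (fun x => (g x)^*).
Proof.
move=> gc; split; apply/continuous_componentsP; split=> x.
  rewrite (_ : @complex.Re R \o _ = fun x => complex.Re (g x)); last first.
    by apply: funext => y /=; rewrite cRe_conj.
  exact: continuousRe.
rewrite (_ : @complex.Im R \o _ = fun x => - complex.Im (g x)); last first.
  by apply: funext => y /=; rewrite cIm_conj.
by apply: cvgN; apply: continuousIm.
Qed.

Lemma cpath_line (a b : C) : cpath (fun x => a + b * cplx x).
Proof.
apply: cpathD; first exact: cpath_cst.
apply: cpathM; first exact: cpath_cst.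
by split=> x; exact: continuous_cplx.
Qed.

Lemma cpath_expi : cpath (@expi R).
Proof. by split=> x; exact: continuous_expi. Qed.

Lemma continuous_RintegralD (f1 f2 : R -> R) a b :
  continuous f1 -> continuous f2 ->
  \int[mu]_(x in `[a, b]) (f1 x + f2 x) =
  \int[mu]_(x in `[a, b]) f1 x + \int[mu]_(x in `[a, b]) f2 x.
Proof.
by move=> f1c f2c; rewrite (RintegralD _ (continuous_integrable a b f1c)
  (continuous_integrable a b f2c)).
Qed.

Lemma continuous_RintegralZ (k : R) (f : R -> R) a b : continuous f ->
  \int[mu]_(x in `[a, b]) (k * f x) = k * \int[mu]_(x in `[a, b]) f x.
Proof.
by move=> fc; rewrite (RintegralZl _ _ (continuous_integrable a b fc)).
Qed.

Lemma eq_cintegral a b g h : (forall x, a <= x <= b -> g x = h x) ->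
  cintegral a b g = cintegral a b h.
Proof.
move=> gh; congr Complex; apply: eq_Rintegral => x;
  by rewrite inE /= in_itv /= => /gh ->.
Qed.

Lemma cintegralD a b g h : cpath g -> cpath h ->
  cintegral a b (fun x => g x + h x) = cintegral a b g + cintegral a b h.
Proof.
move=> gc hc; apply: complexP => /=.
  under eq_Rintegral do rewrite cReD.
  exact: (continuous_RintegralD a b (continuousRe gc) (continuousRe hc)).
under eq_Rintegral do rewrite cImD.
exact: (continuous_RintegralD a b (continuousIm gc) (continuousIm hc)).
Qed.

Lemma cintegralZ a b (k : C) g : cpath g ->
  cintegral a b (fun x => k * g x) = k * cintegral a b g.
Proof.
move=> gc; have gr := continuousRe gc; have gi := continuousIm gc.
have kc (s : R) (f : R -> R) : continuous f -> continuous (fun x => s * f x).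
  by move=> fc x; apply: cvgM; [exact: cvg_cst|exact: fc].
apply: complexP; rewrite ?cReM ?cImM /=.
  under eq_Rintegral do rewrite cReM -mulNr.
  rewrite (continuous_RintegralD a b (kc _ _ gr) (kc _ _ gi)).
  by rewrite (continuous_RintegralZ _ a b gr) (continuous_RintegralZ _ a b gi) mulNr.
under eq_Rintegral do rewrite cImM.
rewrite (continuous_RintegralD a b (kc _ _ gi) (kc _ _ gr)).
by rewrite (continuous_RintegralZ _ a b gr) (continuous_RintegralZ _ a b gi).
Qed.

Lemma cintegralB a b g h : cpath g -> cpath h ->
  cintegral a b (fun x => g x - h x) = cintegral a b g - cintegral a b h.
Proof.
move=> gc hc.
transitivity (cintegral a b (fun x => g x + (-1) * h x)).
  by apply: eq_cintegral => x _; rewrite mulN1r.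
rewrite cintegralD ?cintegralZ ?mulN1r //.
exact: cpathM (cpath_cst _) hc.
Qed.

Lemma cintegral_conj a b g : cpath g ->
  cintegral a b (fun x => (g x)^*) = (cintegral a b g)^*.
Proof.
move=> gc; apply: complexP; rewrite ?cRe_conj ?cIm_conj /=.
  by under eq_Rintegral do rewrite cRe_conj.
under eq_Rintegral do rewrite cIm_conj -mulN1r.
by rewrite (continuous_RintegralZ _ a b (continuousIm gc)) mulN1r.
Qed.

Lemma cintegral_split a b c g : cpath g -> a <= c -> c <= b ->
  cintegral a b g = cintegral a c g + cintegral c b g.
Proof.
have splitR (f : R -> R) : continuous f -> a <= c -> c <= b ->
    \int[mu]_(x in `[a, b]) f x =
    \int[mu]_(x in `[a, c]) f x + \int[mu]_(x in `[c, b]) f x.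
  move=> fc ac cb.
  rewrite -(@Rintegral_itv_obnd_cbnd _ c); last first.
    apply: (@integrableS _ _ _ mu `[c, b]) => //; first exact: subset_itv_oc_cc.
    exact: continuous_integrable.
  rewrite -(@Rintegral_itvB _ f (BLeft a) (BRight b) c) ?bnd_simp //.
    by rewrite addrC subrK.
  exact: continuous_integrable.
move=> gc ac cb; apply: complexP; rewrite ?cReD ?cImD /=.
  exact: (splitR _ (continuousRe gc)).
exact: (splitR _ (continuousIm gc)).
Qed.

(** The factor 2 is the price of bounding real and imaginary parts separately; only the order of
    magnitude matters later. *)
Lemma cintegral_bound a b g (M : R) : cpath g -> a <= b ->
  (forall x, a <= x <= b -> modulus (g x) <= M) ->
  modulus (cintegral a b g) <= 2 * M * (b - a).
Proof.
move=> gc ab gM.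
have boundR (f : R -> R) : continuous f ->
    (forall x, a <= x <= b -> `|f x| <= M) ->
    `|\int[mu]_(x in `[a, b]) f x| <= M * (b - a).
  move=> fc fM; apply: le_trans.
    by apply: le_normr_Rintegral => //; exact: continuous_integrable.
  have -> : M * (b - a) = \int[mu]_(x in `[a, b]) (cst M) x.
    rewrite Rintegral_cst //= lebesgue_measure_itv /= lte_fin.
    move: ab; rewrite le_eqVlt => /orP[/eqP ->|->] //.
    by rewrite ltxx subrr.
  apply: le_Rintegral => //.
  - apply: (continuous_integrable (f := fun x => `|f x|)) => x.
    by apply: cvg_norm; exact: fc.
  - by apply: continuous_integrable => x; exact: cvg_cst.
apply: le_trans (le_modulus_ReIm _) _.
rewrite -mulrA mulr_natl mulr2n; apply: lerD.
  apply: (boundR _ (continuousRe gc)).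
  by move=> x /gM; apply: le_trans; exact: le_Re_modulus.
apply: (boundR _ (continuousIm gc)).
by move=> x /gM; apply: le_trans; exact: le_Im_modulus.
Qed.

Lemma cintegral_FTC a b (G g : R -> C) : a <= b -> cpath g ->
  (forall x, rderiv G x (g x)) -> cintegral a b g = G b - G a.
Proof.
have ftcR (F f : R -> R) : a <= b -> continuous f ->
    (forall x, is_derive x 1 F (f x)) ->
    \int[mu]_(x in `[a, b]) f x = F b - F a.
  rewrite le_eqVlt => /orP[/eqP <- _ _|ab fc dF].
    by rewrite set_itv1 Rintegral_set1 subrr.
  have Fc : continuous F.
    move=> x; apply/differentiable_continuous/derivable1_diffP.
    by have [] := dF x.
  rewrite /Rintegral (@continuous_FTC2 _ _ F) //.
  - exact: continuous_subspaceT.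
  - split; first by move=> x _; have [] := dF x.
      by apply: cvg_at_right_filter; exact: Fc.
    by apply: cvg_at_left_filter; exact: Fc.
  - by move=> x _; rewrite derive1E; have [_ ->] := dF x.
move=> ab gc dG; apply: complexP; rewrite ?cReD ?cReN ?cImD ?cImN /=.
  apply: (ftcR (@complex.Re R \o G) _ ab (continuousRe gc)).
  by move=> x; have /rderiv_components[] := dG x.
apply: (ftcR (@complex.Im R \o G) _ ab (continuousIm gc)).
by move=> x; have /rderiv_components[] := dG x.
Qed.

Lemma cintegral_cst a b (k : C) : a <= b ->
  cintegral a b (fun=> k) = k * cplx (b - a).
Proof.
move=> ab.
rewrite (@cintegral_FTC a b (fun x => 0 + k * cplx x)) //.
- by rewrite cplxB; ring.
- exact: cpath_cst.
- by move=> x; exact: rderiv_line.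
Qed.

End Integral.

(** * The complex exponential *)

Section ComplexExponential.
Variable R : realType.
Local Notation C := (C_of R).
Implicit Types (z w : C) (x y : R).

Lemma cexpD z w : cexp (z + w) = cexp z * cexp w.
Proof.
case: z w => a b [c d]; rewrite /cexp /= expRD cosD sinD cplxM mulrACA.
congr (_ * _); apply: complexP => /=; first by [].
by rewrite addrC.
Qed.

Lemma cexp0 : cexp 0 = 1 :> C.
Proof. by rewrite /cexp /= expR0 cos0 sin0 mul1r. Qed.

Lemma cexp_neq0 z : cexp z != 0.
Proof.
apply/eqP => z0; have := cexpD z (- z).
by rewrite subrr cexp0 z0 mul0r => /eqP; rewrite oner_eq0.
Qed.

Lemma cexp_line x y : cexp (cplx x + 'i%C * cplx y) = cplx (expR x) * expi y.
Proof. by rewrite /cexp cReD cImD cReM cImM /= !(mul0r, mul1r, mulr0, subr0, addr0, add0r). Qed.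

Lemma modulus_expi x : modulus (expi x) = 1.
Proof. by rewrite /modulus normc_def /= cos2Dsin2 sqrtr1. Qed.

Lemma modulus_cexp z : modulus (cexp z) = expR (complex.Re z).
Proof.
by rewrite /cexp modulusM modulus_cplx -/(expi _) modulus_expi mulr1 ger0_norm //.
Qed.

(** The addition formula reduces everything to the point 0, where the derivatives along the two axes
    are those of [expR] and [expi]. *)
Lemma is_derive_cexp z : is_derive z 1 (@cexp R) (cexp z).
Proof.
suff d0 : cderiv (@cexp R) 0 1.
  apply/cderivP => e e0; have z0 : 0 < modulus (cexp z).
    by rewrite modulus_gt0 cexp_neq0.
  have [r r0 rP] := d0 (e / modulus (cexp z)) (divr_gt0 e0 z0).
  exists r => // w wz; have := rP (w - z); rewrite subr0 => /(_ wz).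
  rewrite cexp0 => le1.
  have -> : cexp w - cexp z - cexp z * (w - z) =
      cexp z * (cexp (w - z) - 1 - 1 * (w - z)).
    by rewrite -{1}(subrK z w) (cexpD (w - z) z); ring.
  by rewrite modulusM mulrC -ler_pdivlMr // mulrAC.
have dr : rderiv (fun x => cplx (expR x)) 0 (1 : C).
  apply/rderiv_components; split=> /=; last exact: is_derive_cst.
  by apply: is_derive_eq; rewrite expR0.
have di : rderiv (@expi R) 0 ('i%C : C).
  by have := rderiv_expi (0 : R); rewrite /expi cos0 sin0 mulr1.
move=> e e0.
have e40 : 0 < e / 4 by rewrite divr_gt0.
have [r r0 rP] := dr _ e40; have [s s0 sP] := di _ e40.
exists (Num.min (Num.min r s) (Num.min 1 (e / 4))).
  by rewrite !lt_min r0 s0 ltr01 e40.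
case=> x y; rewrite !subr0; set w := Complex x y; set h := modulus w.
rewrite !lt_min => /andP[/andP[hr hs] /andP[h1 he]].
have xh : `|x| <= h := le_Re_modulus w.
have yh : `|y| <= h := le_Im_modulus w.
have := rP x; have := sP y; rewrite !subr0 => /(_ (le_lt_trans yh hs)) sy.
move=> /(_ (le_lt_trans xh hr)) rx.
move: sy rx; rewrite /expi cos0 sin0 expR0 -/(expi y) cplx1 mul1r.
set A := _ - _ - _ => sy; set B := _ - _ - _ => rx.
(* [B] and [A] are the errors along the real and the imaginary axis; the leftover term i x y is of
   second order. The factor 2 below bounds |1 + x|, since |x| < 1. *)
have -> : cexp w - cexp 0 - 1 * w = B * expi y + (1 + cplx x) * A + cplx x * ('i%C * cplx y).
  have wE : w = cplx x + 'i%C * cplx y by exact: complexE.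
  rewrite cexp0 wE cexp_line /A /B -[Complex 1 0]/(1 : C); ring.
have h0 : 0 <= h by exact: modulus_ge0.
have -> : e * h = e / 4 * h + 2 * (e / 4 * h) + h * (e / 4) by field.
rewrite (le_trans (le_modulusD _ _)) // lerD //.
  rewrite (le_trans (le_modulusD _ _)) // lerD //.
    rewrite modulusM modulus_expi mulr1 (le_trans rx) // ler_wpM2l //.
    exact: ltW.
  rewrite modulusM ler_pM ?modulus_ge0 //.
    rewrite (le_trans (le_modulusD _ _)) // modulus1 modulus_cplx.
    by rewrite (_ : 2 = 1 + 1) // lerD2l (le_trans xh) // ltW.
  rewrite (le_trans sy) // ler_wpM2l //; exact: ltW.
rewrite !modulusM modulus_i mul1r !modulus_cplx ler_pM //.
by rewrite (le_trans yh) // ltW.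
Qed.

Lemma expi_2pi : expi (2 * pi) = expi 0 :> C.
Proof. by rewrite /expi mulr_natl cos2pi sin2pi cos0 sin0. Qed.

Lemma expi_neq0 x : expi x != 0 :> C.
Proof. by rewrite -modulus_eq0 modulus_expi oner_eq0. Qed.

Lemma conj_expi x : (expi x)^* = (expi x)^-1.
Proof.
apply: (mulfI (expi_neq0 x)); rewrite mulfV ?expi_neq0 //.
apply: complexP; rewrite ?cReM ?cImM ?cRe_conj ?cIm_conj /=; last by ring.
by rewrite mulrN opprK -!expr2 cos2Dsin2.
Qed.

End ComplexExponential.

(** * Goursat's theorem for rectangles *)

Section Goursat.
Variable R : realType.
Local Notation C := (C_of R).
Implicit Types (z w : C) (x y a b c d e : R).

Definition hseg (g : C -> C) y a b :=
  cintegral a b (fun x => g (cplx x + 'i%C * cplx y)).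

Definition vseg (g : C -> C) x c d :=
  'i%C * cintegral c d (fun y => g (cplx x + 'i%C * cplx y)).

Definition rect_integral (g : C -> C) a b c d :=
  hseg g c a b + vseg g b c d - hseg g d a b - vseg g a c d.

Lemma cpath_hseg (g : C -> C) y : continuous g ->
  cpath (fun x => g (cplx x + 'i%C * cplx y)).
Proof.
move=> gc; apply: (cpath_comp (f := g)); first by move=> x; exact: gc.
apply: cpathD; last exact: cpath_cst.
by split=> x; exact: continuous_cplx.
Qed.

Lemma cpath_vseg (g : C -> C) x : continuous g ->
  cpath (fun y => g (cplx x + 'i%C * cplx y)).
Proof.
by move=> gc; apply: (cpath_comp (f := g)); [move=> y; exact: gc|exact: cpath_line].
Qed.

Lemma rect_integralB (g h : C -> C) a b c d : continuous g -> continuous h ->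
  rect_integral (fun w => g w - h w) a b c d =
  rect_integral g a b c d - rect_integral h a b c d.
Proof.
move=> gc hc; rewrite /rect_integral /hseg /vseg.
rewrite !(cintegralB _ _ (cpath_hseg _ gc) (cpath_hseg _ hc)).
rewrite !(cintegralB _ _ (cpath_vseg _ gc) (cpath_vseg _ hc)).
by ring.
Qed.

(** An affine function has the quadratic primitive [F], whose differences between corners telescope
    around the boundary. *)
Lemma rect_integral_affine (p q : C) a b c d : a <= b -> c <= d ->
  rect_integral (fun w => p + q * w) a b c d = 0.
Proof.
move=> ab cd; pose F w := p * w + q / 2 * w ^+ 2.
have dA w : is_derive w 1 (fun w : C => p + q * w) (0 + (0 * w + q * 1)).
  exact: cderivD (cderiv_cst p w) (cderivM (cderiv_cst q w) (cderiv_id w)).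
have ac : continuous (fun w : C => p + q * w).
  by move=> w; exact: is_derive_continuous (dA w).
have dF w : is_derive w 1 F (p + q * w).
  apply: is_derive_eq (cderivD (cderivM (cderiv_cst p w) (cderiv_id w))
    (cderivM (cderiv_cst (q / 2) w) (cderivX 2 (cderiv_id w)))) _.
  by rewrite /= expr1; field.
have hE y : hseg (fun w => p + q * w) y a b =
    F (cplx b + 'i%C * cplx y) - F (cplx a + 'i%C * cplx y).
  rewrite /hseg (@cintegral_FTC _ a b (fun x => F (cplx x + 'i%C * cplx y))) //.
    exact: (cpath_hseg y ac).
  move=> x; rewrite -[X in rderiv _ _ X]mulr1.
  apply: (rderiv_comp (f := F) (dF _)).
  rewrite (_ : (fun x => _) = fun x => 'i%C * cplx y + 1 * cplx x).
    exact: rderiv_line.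
  by apply: funext => t; ring.
have vE x : vseg (fun w => p + q * w) x c d =
    F (cplx x + 'i%C * cplx d) - F (cplx x + 'i%C * cplx c).
  rewrite /vseg -cintegralZ; last exact: (cpath_vseg x ac).
  rewrite (@cintegral_FTC _ c d (fun y => F (cplx x + 'i%C * cplx y))) //.
    by apply: cpathM; [exact: cpath_cst|exact: (cpath_vseg x ac)].
  move=> y; rewrite [X in rderiv _ _ X]mulrC.
  by apply: (rderiv_comp (f := F) (dF _)); exact: rderiv_line.
by rewrite /rect_integral !hE !vE; ring.
Qed.

(** The perimeter is 2 ((b - a) + (d - c)), and [cintegral_bound] contributes another factor 2. *)
Lemma rect_integral_bound (g : C -> C) a b c d (M : R) : continuous g ->
  a <= b -> c <= d ->
  (forall x y, a <= x <= b -> c <= y <= d ->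
    modulus (g (cplx x + 'i%C * cplx y)) <= M) ->
  modulus (rect_integral g a b c d) <= 4 * M * ((b - a) + (d - c)).
Proof.
move=> gc ab cd gM.
have hM y : c <= y <= d -> modulus (hseg g y a b) <= 2 * M * (b - a).
  move=> yc; apply: cintegral_bound => //; first exact: (cpath_hseg _ gc).
  by move=> x xa; exact: gM.
have vM x : a <= x <= b -> modulus (vseg g x c d) <= 2 * M * (d - c).
  move=> xa; rewrite /vseg modulusM modulus_i mul1r.
  apply: cintegral_bound => //; first exact: (cpath_vseg _ gc).
  by move=> y yc; exact: gM.
have -> : 4 * M * (b - a + (d - c)) =
  2 * M * (b - a) + 2 * M * (d - c) + 2 * M * (b - a) + 2 * M * (d - c) by ring.
rewrite /rect_integral (le_trans (le_modulusB _ _)) //.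
apply: lerD; last by apply: vM; rewrite lexx.
apply: le_trans (le_modulusB _ _) _; apply: lerD; last by apply: hM; rewrite lexx cd.
apply: le_trans (le_modulusD _ _) _; apply: lerD.
  by apply: hM; rewrite lexx.
by apply: vM; rewrite lexx ab.
Qed.

Lemma rect_integral_split (g : C -> C) a b c d m k : continuous g ->
  a <= m -> m <= b -> c <= k -> k <= d ->
  rect_integral g a b c d =
  rect_integral g a m c k + rect_integral g m b c k +
  (rect_integral g a m k d + rect_integral g m b k d).
Proof.
move=> gc am mb ck kd; rewrite /rect_integral.
have hE y : hseg g y a b = hseg g y a m + hseg g y m b.
  by apply: cintegral_split => //; exact: (cpath_hseg _ gc).
have vE x : vseg g x c d = vseg g x c k + vseg g x k d.
  rewrite /vseg -mulrDr; congr (_ * _).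
  by apply: cintegral_split => //; exact: (cpath_vseg _ gc).
by rewrite !hE !vE; ring.
Qed.

(** Intervals are given by left end and length, like the rectangles of the bisection; the common
    point is the supremum of the left ends. *)
Lemma nested_intervals (u l : nat -> R) : (forall k, 0 <= l k) ->
  (forall k, u k <= u k.+1) -> (forall k, u k.+1 + l k.+1 <= u k + l k) ->
  exists x, forall k, u k <= x <= u k + l k.
Proof.
move=> l0 u_incr v_decr.
have uM j k : (j <= k)%N -> u j <= u k by exact: (nondecreasing_seqP u).1.
have vM j k : (j <= k)%N -> u k + l k <= u j + l j.
  exact: (nonincreasing_seqP (fun k => u k + l k)).1.
have uv j k : u j <= u k + l k.
  have [jk|/ltnW kj] := leqP j k; first by rewrite (le_trans (uM _ _ jk)) // lerDl.
  by rewrite (le_trans _ (vM _ _ kj)) // lerDl.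
exists (sup (range u)) => k; apply/andP; split.
  apply: ub_le_sup; last by exists k.
  by exists (u 0 + l 0) => _ [j _ <-].
apply: ge_sup; first by exists (u 0), 0.
by move=> _ [j _ <-].
Qed.

(** Bisection step: were all four quarters to contribute less than B / 4, the whole would fall below
    B. *)
Lemma quarter_rect (g : C -> C) a c (w h B : R) : continuous g ->
  0 <= w -> 0 <= h ->
  B <= modulus (rect_integral g a (a + (w + w)) c (c + (h + h))) ->
  exists p : R * R, [/\ B <= 4 * modulus (rect_integral g p.1 (p.1 + w) p.2 (p.2 + h)),
    a <= p.1 <= a + w & c <= p.2 <= c + h].
Proof.
move=> gc w0 h0 leB.
have aw : a <= a + w by rewrite lerDl.
have ch : c <= c + h by rewrite lerDl.
pose Q p := modulus (rect_integral g p.1 (p.1 + w) p.2 (p.2 + h)).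
have {leB} : B <= Q (a, c) + Q (a + w, c) + (Q (a, c + h) + Q (a + w, c + h)).
  have tri (z1 z2 z3 z4 : C) : modulus (z1 + z2 + (z3 + z4)) <=
      modulus z1 + modulus z2 + (modulus z3 + modulus z4).
    by apply: le_trans (le_modulusD _ _) _; apply: lerD; exact: le_modulusD.
  have awv : a + w <= a + w + w by rewrite lerDl.
  have chv : c + h <= c + h + h by rewrite lerDl.
  move: leB; rewrite (addrA a w w) (addrA c h h) => leB.
  apply: le_trans leB _; rewrite (rect_integral_split gc aw awv ch chv).
  exact: tri.
have [h1|h1] := leP B (4 * Q (a, c)).
  by exists (a, c); split; rewrite ?lexx.
have [h2|h2] := leP B (4 * Q (a + w, c)).
  by exists (a + w, c); split; rewrite ?lexx ?aw ?ch.
have [h3|h3] := leP B (4 * Q (a, c + h)).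
  by exists (a, c + h); split; rewrite ?lexx ?aw ?ch.
have [h4|h4] := leP B (4 * Q (a + w, c + h)).
  by exists (a + w, c + h); split; rewrite ?lexx ?aw ?ch.
move: h1 h2 h3 h4; move: (Q _) (Q _) (Q _) (Q _) => *; exfalso; lra.
Qed.

(** Near [z] the function is its tangent map up to e |w - z|, and the tangent map integrates to
    zero. The bound is quadratic in the size, which is what compensates the factor 4^k in
    [goursat]. *)
Lemma rect_integral_local (g : C -> C) z : continuous g -> derivable g z 1 ->
  forall e, 0 < e -> exists2 r : R, 0 < r & forall a b c d,
    a <= complex.Re z <= b -> c <= complex.Im z <= d ->
    b - a + (d - c) < r ->
    modulus (rect_integral g a b c d) <= 4 * e * (b - a + (d - c)) ^+ 2.
Proof.
move=> gc /derivableP; move: ('D_1 g z) => q gd e e0.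
have /cderivP gd' := gd; have [r r0 rP] := gd' _ e0.
exists r => // a b c d /andP[az zb] /andP[cz zd]; set s := _ + _ => sr.
have ab : a <= b by exact: le_trans zb.
have cd : c <= d by exact: le_trans zd.
pose p := g z - q * z; pose A (w : C) := p + q * w.
have Ac : continuous A.
  move=> w; apply: (@is_derive_continuous _ A w (0 + (0 * w + q * 1))).
  exact: cderivD (cderiv_cst p w) (cderivM (cderiv_cst q w) (cderiv_id w)).
have -> : rect_integral g a b c d = rect_integral (fun w => g w - A w) a b c d.
  by rewrite (rect_integralB _ _ _ _ gc Ac) (rect_integral_affine _ _ ab cd) subr0.
have Bc : continuous (fun w => g w - A w).
  move=> w; apply: (@continuousB _ _ _ g A); [exact: gc|exact: Ac].
have -> : 4 * e * s ^+ 2 = 4 * (e * s) * s by ring.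
apply: (rect_integral_bound Bc ab cd) => x y /andP[ax xb] /andP[cy yd].
set w := cplx x + _.
have ws : modulus (w - z) <= s.
  apply: le_trans (le_modulus_ReIm _) _.
  rewrite (cReD w) (cImD w) cReN cImN Re_cartesian Im_cartesian /s.
  by rewrite lerD // ler_norml; apply/andP; split; lra.
have -> : g w - A w = g w - g z - q * (w - z) by rewrite /A /p; ring.
rewrite (le_trans (rP _ (le_lt_trans ws sr))) // ler_wpM2l //.
exact: ltW.
Qed.

Lemma goursat (g : C -> C) a b c d : continuous g -> a <= b -> c <= d ->
  (forall x y, a <= x <= b -> c <= y <= d ->
    derivable g (cplx x + 'i%C * cplx y) 1) ->
  rect_integral g a b c d = 0.
Proof.
move=> gc ab cd gd.
pose W k := (b - a) / 2 ^+ k; pose H k := (d - c) / 2 ^+ k.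
have W0 k : 0 <= W k by rewrite divr_ge0 ?subr_ge0 // exprn_ge0.
have H0 k : 0 <= H k by rewrite divr_ge0 ?subr_ge0 // exprn_ge0.
have n2 k : (2 : R) ^+ k != 0 by rewrite expf_neq0.
have WS k : W k = W k.+1 + W k.+1 by rewrite /W exprS; field.
have HS k : H k = H k.+1 + H k.+1 by rewrite /H exprS; field.
set B := modulus (rect_integral g a b c d).
pose P k (p : R * R) :=
  B <= 4 ^+ k * modulus (rect_integral g p.1 (p.1 + W k) p.2 (p.2 + H k)).
(* The invariant is a premise inside the existential, so that [choice] yields a total selection
   function; where the premise fails, an arbitrary point serves. *)
have step (kp : nat * (R * R)) : exists q : R * R, P kp.1 kp.2 ->
    [/\ P kp.1.+1 q, kp.2.1 <= q.1 <= kp.2.1 + W kp.1.+1 &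
      kp.2.2 <= q.2 <= kp.2.2 + H kp.1.+1].
  case: kp => k p /=; have [Pp|/negP nPp] := boolP `[< P k p >]; last first.
    by exists p => Pp; case: nPp; exact/asboolP.
  move/asboolP : Pp => Pp.
  have := @quarter_rect g p.1 p.2 (W k.+1) (H k.+1)
    (modulus (rect_integral g p.1 (p.1 + W k) p.2 (p.2 + H k))) gc (W0 _) (H0 _).
  rewrite {1}WS {1}HS lexx => /(_ isT)[q [q1 q2 q3]]; exists q => _; split=> //.
  apply: le_trans Pp _; rewrite exprSr -mulrA ler_wpM2l ?exprn_ge0 //.
have [f fP] := choice step.
pose u := fix u k := if k is k'.+1 then f (k', u k') else (a, c).
have uP k : P k (u k).
  elim: k => [|k IH]; last by have [] := fP (k, u k) IH.
  by rewrite /P /= expr0 mul1r /W /H expr0 !divr1 !subrKC lexx.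
have uS k := fP (k, u k) (uP k).
have [x xP] : exists x, forall k, (u k).1 <= x <= (u k).1 + W k.
  apply: nested_intervals => // k; have [_ /andP[h1 h2] _] := uS k => //=.
  by rewrite [leRHS](_ : _ = (u k).1 + W k.+1 + W k.+1) ?lerD2r // -addrA -WS.
have [y yP] : exists y, forall k, (u k).2 <= y <= (u k).2 + H k.
  apply: nested_intervals => // k; have [_ _ /andP[h1 h2]] := uS k => //=.
  by rewrite [leRHS](_ : _ = (u k).2 + H k.+1 + H k.+1) ?lerD2r // -addrA -HS.
set z := cplx x + 'i%C * cplx y.
have rez : complex.Re z = x by exact: Re_cartesian.
have imz : complex.Im z = y by exact: Im_cartesian.
have dz : derivable g z 1.
  apply: gd; [have := xP 0|have := yP 0];
    by rewrite /= /W /H expr0 divr1 subrKC.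
set s := b - a + (d - c).
have s0 : 0 <= s by rewrite addr_ge0 // subr_ge0.
apply/eqP; rewrite -modulus_eq0 eq_le modulus_ge0 andbT -/B.
apply/ler_addgt0Pr => e e0; rewrite add0r.
(* The summand 1 keeps the quotient meaningful when the rectangle is a single point, that is, s =
   0. *)
have e10 : 0 < e / (4 * s ^+ 2 + 1).
  by rewrite divr_gt0 // ltr_wpDl // mulr_ge0 // sqr_ge0.
have [r r0 rP] := rect_integral_local gc dz e10.
have [k kr] : exists k, s / 2 ^+ k < r.
  have : (fun k => geometric s 2^-1 k) @ \oo --> (0 : R).
    by apply: cvg_geometric; rewrite ger0_norm ?invr_ge0 // invf_lt1 // ltr1n.
  move/cvgrPdist_lt => /(_ _ r0)[k _ /(_ k (leqnn k))] /=.
  rewrite sub0r normrN => kr; exists k; apply: le_lt_trans kr.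
  by rewrite /geometric /= exprVn ler_norm.
have := rP (u k).1 ((u k).1 + W k) (u k).2 ((u k).2 + H k).
rewrite rez imz => /(_ (xP k) (yP k)).
have -> : (u k).1 + W k - (u k).1 + ((u k).2 + H k - (u k).2) = s / 2 ^+ k.
  by rewrite /W /H /s mulrDl; ring.
move=> /(_ kr) Jk; apply: le_trans (uP k) _.
apply: (@le_trans _ _ (4 ^+ k * (4 * (e / (4 * s ^+ 2 + 1)) * (s / 2 ^+ k) ^+ 2))).
  by rewrite ler_wpM2l ?exprn_ge0.
have -> : 4 ^+ k * (4 * (e / (4 * s ^+ 2 + 1)) * (s / 2 ^+ k) ^+ 2) =
    e / (4 * s ^+ 2 + 1) * (4 * s ^+ 2).
  have -> : (4 : R) ^+ k = (2 ^+ k) ^+ 2.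
    by rewrite -exprM mulnC exprM; congr (_ ^+ _); rewrite expr2 -natrM.
  by field; rewrite n2 gt_eqF // ltr_wpDl // mulr_ge0 // sqr_ge0.
rewrite mulrAC ler_pdivrMr ?ltr_wpDl ?mulr_ge0 ?sqr_ge0 //.
by rewrite ler_wpM2l ?lerDl // ltW.
Qed.

End Goursat.

(** * Entire functions that are real on the unit circle *)

Section RealOnCircle.
Variable R : realType.
Local Notation C := (C_of R).
Implicit Types (z w : C) (x y e : R) (f g : C -> C).

(** For g = f o exp this is 2 pi times the mean of f over the circle of radius e^x. *)
Definition vmean g x : C :=
  cintegral 0 (2 * pi) (fun y => g (cplx x + 'i%C * cplx y)).

Let tau_ge0 : 0 <= 2 * pi :> R.
Proof. by rewrite mulr_ge0 // pi_ge0. Qed.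

Let cancelE e : 2 * (e / (2 * (2 * pi))) * (2 * pi) = e.
Proof.
have : 2 * pi != 0 :> R by rewrite mulf_neq0 // lt0r_neq0 // pi_gt0.
by move: (2 * pi) => P P0; field.
Qed.

(** Compactness of [0, 2 pi] makes the continuity uniform in y. *)
Lemma near_vertical_line g x0 e : continuous g -> 0 < e ->
  exists2 r : R, 0 < r & forall x, `|x - x0| < r ->
    forall y, 0 <= y <= 2 * pi ->
    modulus (g (cplx x + 'i%C * cplx y) - g (cplx x0 + 'i%C * cplx y)) <= e.
Proof.
move=> gc e0.
have := (@compact_near_coveringP R `[0, 2 * pi]).1 (@segment_compact R 0 (2 * pi)).
move=> /(_ R (nbhs x0) (fun x y => modulus (g (cplx x + 'i%C * cplx y) -
  g (cplx x0 + 'i%C * cplx y)) <= e) _).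
case.
  move=> y _; have e20 : 0 < e / 2 by rewrite divr_gt0.
  have [r r0 rP] := (continuous_modulusP g (cplx x0 + 'i%C * cplx y)).1 (gc _) _ e20.
  have r20 : 0 < r / 2 by rewrite divr_gt0.
  exists (ball y (r / 2), ball x0 (r / 2)).
    by split; apply/nbhs_ballP; exists (r / 2).
  case=> y' x' [/=]; rewrite /ball /= => yy' xx'.
  set p := cplx x0 + _ in rP; set p1 := cplx x' + _; set p2 := cplx x0 + 'i%C * cplx y'.
  have y'y : `|y' - y| < r / 2 by rewrite distrC.
  have x'x : `|x' - x0| < r / 2 by rewrite distrC.
  have p1p : modulus (p1 - p) < r.
    apply: le_lt_trans (_ : `|x' - x0| + `|y' - y| < _); last first.
      by rewrite (splitr r) ltrD.
    have -> : p1 - p = cplx (x' - x0) + 'i%C * cplx (y' - y).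
      by rewrite /p1 /p !cplxB; ring.
    apply: le_trans (le_modulusD _ _) _.
    by rewrite modulusM modulus_i mul1r !modulus_cplx.
  have p2p : modulus (p2 - p) < r.
    have -> : p2 - p = 'i%C * cplx (y' - y) by rewrite /p2 /p cplxB; ring.
    rewrite modulusM modulus_i mul1r modulus_cplx (lt_trans y'y) //.
    by rewrite ltr_pdivrMr // ltr_pMr // ltr1n.
  have -> : g p1 - g p2 = (g p1 - g p) - (g p2 - g p) by ring.
  apply: le_trans (le_modulusB _ _) _.
  by rewrite (splitr e) lerD // rP.
move=> r r0 rP; exists r => // x xr y y01; apply: rP.
  by rewrite /= distrC.
by rewrite /= in_itv.
Qed.

Lemma vmean_near g x0 e : continuous g -> 0 < e ->
  exists2 r : R, 0 < r & forall x, `|x - x0| < r ->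
    modulus (vmean g x - vmean g x0) <= 2 * e * (2 * pi).
Proof.
move=> gc e0; have [r r0 rP] := near_vertical_line x0 gc e0.
exists r => // x xr; rewrite /vmean.
rewrite -(cintegralB _ _ (cpath_vseg x gc) (cpath_vseg x0 gc)).
have := cintegral_bound (cpathB (cpath_vseg x gc) (cpath_vseg x0 gc)) tau_ge0 (rP x xr).
by rewrite subr0.
Qed.

(** On either side of the line Re w = x0, Goursat's theorem applies to rectangles of height 2 pi,
    whose horizontal sides cancel by periodicity; continuity of the mean joins the two sides. The
    exceptional line leaves room for a point where only continuity is known. *)
Lemma vmean_const g x0 : continuous g ->
  (forall w, g (w + 'i%C * cplx (2 * pi)) = g w) ->
  (forall w, complex.Re w != x0 -> derivable g w 1) ->
  forall x x', vmean g x = vmean g x'.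
Proof.
move=> gc gper gd.
have step x x' : x <= x' -> ~~ (x <= x0 <= x') -> vmean g x = vmean g x'.
  move=> xx' x0N.
  have : rect_integral g x x' 0 (2 * pi) = 0.
    apply: (goursat gc xx' tau_ge0) => u v /andP[xu ux'] _; apply: gd.
    rewrite Re_cartesian; apply: contra x0N => /eqP <-; exact/andP.
  rewrite /rect_integral.
  have -> : hseg g (2 * pi) x x' = hseg g 0 x x'.
    by apply: eq_cintegral => u _; rewrite cplx0 mulr0 addr0 gper.
  move/eqP; rewrite [X in X - _]addrAC subrr add0r subr_eq0 => /eqP.
  have i0 : 'i%C != 0 :> C by rewrite -modulus_eq0 modulus_i oner_eq0.
  by move/(mulfI i0).
suff v0 x : vmean g x = vmean g x0 by move=> x x'; rewrite !v0.
have [->//|xNx0] := eqVneq x x0.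
apply/eqP; rewrite -subr_eq0 -modulus_eq0 eq_le modulus_ge0 andbT.
apply/ler_addgt0Pr => e e0; rewrite add0r.
have k0 : 0 < 2 * (2 * pi) :> R by rewrite !mulr_gt0 // pi_gt0.
have [r r0 rP] := vmean_near x0 gc (divr_gt0 e0 k0).
have close u : `|u - x0| < r -> modulus (vmean g u - vmean g x0) <= e.
  by move=> /rP; rewrite cancelE.
have r20 : 0 < r / 2 by rewrite divr_gt0.
have r2r : r / 2 < r by rewrite ltr_pdivrMr // ltr_pMr // ltr1n.
have [xx0|x0x] : x < x0 \/ x0 < x by apply/orP; rewrite -neq_lt.
  have [xr|rx] := leP x (x0 - r / 2); last first.
    by apply: close; rewrite ltr0_norm ?subr_lt0 //; lra.
  rewrite (step _ _ xr); last by apply/negP => /andP[_]; lra.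
  by apply: close; rewrite ltr0_norm; lra.
have [xr|rx] := leP (x0 + r / 2) x; last first.
  by apply: close; rewrite gtr0_norm ?subr_gt0 //; lra.
rewrite -(step _ _ xr); last by apply/negP => /andP[]; lra.
by apply: close; rewrite gtr0_norm; lra.
Qed.

Lemma cexp_period w : cexp (w + 'i%C * cplx (2 * pi)) = cexp w.
Proof.
rewrite cexpD -{2}[cexp w]mulr1; congr (_ * _).
rewrite -[_ * _]add0r -[0]/(cplx 0) cexp_line expR0 expi_2pi mul1r.
by rewrite /expi cos0 sin0.
Qed.

Lemma cderiv_cexp_comp f w d : is_derive (cexp w) 1 f d ->
  is_derive w 1 (fun w => f (cexp w)) (d * cexp w).
Proof. by move=> fd; exact: cderiv_comp fd (is_derive_cexp w). Qed.

Lemma mean_value f z0 x : continuous f ->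
  (forall z, z != z0 -> derivable f z 1) ->
  vmean (fun w => f (cexp w)) x = f 0 * cplx (2 * pi).
Proof.
move=> fc fd; pose g w := f (cexp w).
have gc : continuous g.
  by move=> w; apply: (continuous_comp (@continuous_cexp R w)); exact: fc.
have vconst x' : vmean g x = vmean g x'.
  (* All w with exp w = z0 lie on the line Re w = ln |z0|. For z0 = 0 there are none, and the
     default value of ln 0 is harmless. *)
  apply: (@vmean_const g (ln (modulus z0)) gc) => w.
    by rewrite /g cexp_period.
  move=> wN; have [d fd'] : exists d, is_derive (cexp w) 1 f d.
    exists ('D_1 f (cexp w)); apply/derivableP/fd.
    apply: contra wN => /eqP <-.
    by rewrite modulus_cexp expRK.
  by have [] := cderiv_cexp_comp fd'.
apply/eqP; rewrite -subr_eq0 -modulus_eq0 eq_le modulus_ge0 andbT.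
apply/ler_addgt0Pr => e e0; rewrite add0r.
have k0 : 0 < 2 * (2 * pi) :> R by rewrite !mulr_gt0 // pi_gt0.
have [r r0 rP] := (continuous_modulusP f 0).1 (fc 0) _ (divr_gt0 e0 k0).
have r20 : 0 < r / 2 by rewrite divr_gt0.
have r2r : r / 2 < r by rewrite ltr_pdivrMr // ltr_pMr // ltr1n.
(* The mean is moved to the circle of radius r / 2, on which f is close to f 0. *)
rewrite -/g (vconst (ln (r / 2))) -[in cplx _](subr0 (2 * pi)).
rewrite -(cintegral_cst _ tau_ge0) /vmean.
have c1 : cpath (fun y => g (cplx (ln (r / 2)) + 'i%C * cplx y)) by exact: cpath_vseg.
rewrite -(cintegralB _ _ c1 (cpath_cst (f 0))).
apply: le_trans (cintegral_bound (M := e / (2 * (2 * pi))) (cpathB c1 (cpath_cst (f 0))) tau_ge0 _) _.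
  move=> y _; apply: rP; rewrite subr0 modulus_cexp Re_cartesian lnK //.
by rewrite subr0 cancelE.
Qed.

Lemma entire_continuous f : entire f -> continuous f.
Proof. by move=> fd z; apply: is_derive_continuous (derivableP (fd z)). Qed.

Lemma mean_power f n x : entire f ->
  vmean (fun w => cexp w ^+ n.+1 * f (cexp w)) x = 0.
Proof.
move=> fd; pose h z := z ^+ n.+1 * f z.
have hd z : derivable h z 1.
  by have [] := cderivM (cderivX n.+1 (cderiv_id z)) (derivableP (fd z)).
have -> := @mean_value h 0 x (entire_continuous hd) (fun z _ => hd z).
by rewrite /h exprS !mul0r.
Qed.

(** A negative power blows up at 0, so the circle cannot be shrunk; the mean is moved to the unit
    circle instead, where it is the conjugate of the one in [mean_power]. *)
Lemma mean_negpower f n x : entire f ->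
  (forall z, modulus z = 1 -> (f z)^* = f z) ->
  vmean (fun w => (cexp w ^+ n.+1)^-1 * f (cexp w)) x = 0.
Proof.
move=> fd freal; pose g w := (cexp w ^+ n.+1)^-1 * f (cexp w).
have n0 (w : C) : cexp w ^+ n.+1 != 0 by rewrite expf_neq0 // cexp_neq0.
have gd w : derivable g w 1.
  by have [] := cderivM (cderivV (f := fun w => cexp w ^+ n.+1) (n0 w) (cderivX n.+1 (is_derive_cexp w)))
    (cderiv_cexp_comp (derivableP (fd (cexp w)))).
have gc : continuous g by exact: entire_continuous.
rewrite -/g (@vmean_const g 0 gc _ _ x 0) //; last by move=> w; rewrite /g cexp_period.
have := mean_power n 0 fd; rewrite /vmean => /(congr1 Num.conj).
rewrite conjC0 -cintegral_conj; last first.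
  apply: (@cpath_vseg _ (fun w => cexp w ^+ n.+1 * f (cexp w)) 0).
  apply: entire_continuous => w.
  by have [] := cderivM (cderivX n.+1 (is_derive_cexp w))
    (cderiv_cexp_comp (derivableP (fd (cexp w)))).
move=> <-; apply: eq_cintegral => y _.
rewrite /g cexp_line expR0 mul1r rmorphM rmorphXn /= conj_expi exprVn.
by rewrite freal // modulus_expi.
Qed.

Lemma cpath_bounded (g : R -> C) a b : a <= b -> cpath g ->
  exists2 M : R, 0 <= M & forall x, a <= x <= b -> modulus (g x) <= M.
Proof.
move=> ab [gc]; have [c _ cP] : exists2 c, c \in `[a, b]%R &
    forall t, t \in `[a, b]%R -> modulus (g t) <= modulus (g c).
  apply: (@EVT_max R (fun x => modulus (g x))) => //.
  apply: continuous_subspaceT => x; apply/cvgrPdist_le => e e0.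
  have := (@cvg_modulusP _ _ _ (nbhs_filter x) g (g x)).1 (gc x) e e0.
  apply: filterS => y ge; rewrite distrC (le_trans _ ge) // ler_norml.
  rewrite lerNl opprB le_modulus_dist modulusB.
  by rewrite le_modulus_dist.
exists (modulus (g c)) => [|x xab]; first exact: modulus_ge0.
by apply: cP; rewrite in_itv.
Qed.

(** The integrand equals t (f t - f z0) / (t - z0); once the gap at z0 is filled, this function is 0
    at t = 0, and so is its mean. *)
Lemma removable_mean f z0 x : entire f -> z0 != 0 -> modulus z0 != expR x ->
  cintegral 0 (2 * pi) (fun y => let t := cexp (cplx x + 'i%C * cplx y) in
    (f t - f z0) * (1 - z0 / t)^-1) = 0.
Proof.
move=> fd z00 xz0.
(* The value at z0 makes [F] continuous there; differentiability at z0 is avoided by taking z0 as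
   the exceptional point of [mean_value]. *)
pose F z := if z == z0 then 'D_1 f z0 * z0 else (f z - f z0) / (z - z0) * z.
have Fd z : z != z0 -> derivable F z 1.
  move=> zz0; have zz : z - z0 != 0 by rewrite subr_eq0.
  have := cderivM (cderivM (cderivB (derivableP (fd z)) (cderiv_cst (f z0) z))
    (cderivV (f := fun w => w - z0) zz (cderivB (cderiv_id z) (cderiv_cst z0 z)))) (cderiv_id z).
  move=> [+ _]; apply: near_eq_derivable; apply/nbhs_modulusP.
  exists (modulus (z - z0)) => [|w]; first by rewrite modulus_gt0.
  rewrite /F; case: eqVneq => // ->.
  by rewrite modulusB ltxx.
have Fc : continuous F.
  move=> z; have [->|zz0] := eqVneq z z0; last first.
    exact: is_derive_continuous (derivableP (Fd z zz0)).
  apply/continuous_modulusP => e e0.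
  set d := 'D_1 f z0 in F Fd *.
  have /cderivP fd' := derivableP (fd z0).
  pose k := modulus z0 + 1; have k0 : 0 < k by rewrite ltr_wpDl // modulus_ge0.
  have [r r0 rP] := fd' _ (divr_gt0 e0 (mulr_gt0 (ltr0Sn R 1) k0)).
  pose m := modulus d + 1; have m0 : 0 < m by rewrite ltr_wpDl // modulus_ge0.
  exists (Num.min (Num.min r 1) (e / (2 * m))).
    by rewrite !lt_min r0 ltr01 divr_gt0 // mulr_gt0.
  move=> w; rewrite !lt_min => /andP[/andP[wr w1] we].
  rewrite /F eqxx; case: eqVneq => [_|ww0].
    by rewrite subrr modulus0 ltW.
  have ww : w - z0 != 0 by rewrite subr_eq0.
  have -> : (f w - f z0) / (w - z0) * w - d * z0 =
      (f w - f z0 - d * (w - z0)) / (w - z0) * w + d * (w - z0) by field.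
  rewrite (splitr e) (le_trans (le_modulusD _ _)) // lerD //.
    rewrite !modulusM modulusV.
    have -> : e / 2 = e / (2 * k) * k by field; rewrite gt_eqF.
    apply: ler_pM; rewrite ?mulr_ge0 ?invr_ge0 ?modulus_ge0 //.
      by rewrite ler_pdivrMr ?modulus_gt0 // rP.
    rewrite -lerBlDl (le_trans (le_modulus_dist _ _)) // ltW //.
  rewrite modulusM.
  have -> : e / 2 = m * (e / (2 * m)) by field; rewrite gt_eqF.
  by apply: ler_pM; rewrite ?modulus_ge0 ?lerDl // ltW.
have := mean_value x Fc Fd.
rewrite {2}/F eq_sym (negbTE z00) mulr0 mul0r => <-.
apply: eq_cintegral => y _ /=; set t := cexp _.
have tz0 : t != z0.
  by apply: contra xz0 => /eqP <-; rewrite modulus_cexp Re_cartesian.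
have tz : t - z0 != 0 by rewrite subr_eq0.
have t0 : t != 0 by rewrite cexp_neq0.
by rewrite /F (negbTE tz0); field; rewrite tz t0.
Qed.

Lemma entire_real_on_circle f : entire f ->
  (forall z, modulus z = 1 -> (f z)^* = f z) -> forall z, f z = f 0.
Proof.
move=> fd freal z0; have [->//|z00] := eqVneq z0 0.
have m0 : 0 < modulus z0 + 1 by rewrite ltr_wpDl // modulus_ge0.
(* On a circle of radius |z0| + 1 the ratio |z0 / t| is a constant less than 1. *)
pose x := ln (modulus z0 + 1); pose t y := cexp (cplx x + 'i%C * cplx y).
have mt y : modulus (t y) = modulus z0 + 1 by rewrite modulus_cexp Re_cartesian lnK.
have t0 y : t y != 0 by exact: cexp_neq0.
have tz y : t y - z0 != 0.
  rewrite subr_eq0; apply/eqP => tz0; have := mt y; rewrite tz0 => /eqP.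
  by rewrite -{1}[modulus z0]addr0 (inj_eq (addrI _)) eq_sym oner_eq0.
have q1 y : 1 - z0 / t y != 0.
  by rewrite -(mulfV (t0 y)) -mulrBl mulf_neq0 ?tz ?invr_neq0 ?t0.
have tc : cpath t.
  by apply: (@cpath_vseg _ (@cexp R)); exact: continuous_cexp.
have qc : cpath (fun y => z0 / t y) by apply: cpathM (cpath_cst _) (cpathV _ tc).
have Kc : cpath (fun y => f (t y) - f z0).
  apply: cpathB (cpath_cst _).
  by apply: (cpath_comp (f := f) _ tc) => y; exact: entire_continuous.
have Dc : cpath (fun y => (f (t y) - f z0) * (1 - z0 / t y)^-1).
  by apply: cpathM Kc (cpathV _ (cpathB (cpath_cst _) qc)).
(* [S N] is the remainder of the geometric series for (1 - z0 / t)^-1 after N terms. [S 0] vanishes,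
   the term of index 0 gives f z0 - f 0 up to a factor, and all later terms vanish. So [S 1] is a
   multiple of f z0 - f 0 and also the limit of [S N], which is 0. *)
pose S N := cintegral 0 (2 * pi)
  (fun y => (z0 / t y) ^+ N * ((f (t y) - f z0) * (1 - z0 / t y)^-1)).
have Sc N : cpath (fun y => (z0 / t y) ^+ N *
    ((f (t y) - f z0) * (1 - z0 / t y)^-1)).
  exact: cpathM (cpathX N qc) Dc.
have S0 : S 0 = 0.
  rewrite -(@removable_mean f z0 x fd z00) => [|]; last first.
    by rewrite lnK // lt_eqF // ltrDl.
  by apply: eq_cintegral => y _; rewrite expr0 mul1r.
have SS N : S N - S N.+1 =
    cintegral 0 (2 * pi) (fun y => (z0 / t y) ^+ N * (f (t y) - f z0)).
  rewrite /S -(cintegralB _ _ (Sc N) (Sc N.+1)); apply: eq_cintegral => y _.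
  by rewrite exprS; field; rewrite ?t0 ?tz ?q1.
have S1 : S 1 = (f z0 - f 0) * cplx (2 * pi).
  have := SS 0; rewrite S0 sub0r => /eqP; rewrite eqr_oppLR => /eqP ->.
  under eq_fun do rewrite expr0 mul1r.
  have ftc : cpath (fun y => f (t y)).
    by apply: (cpath_comp (f := f) _ tc) => y; exact: entire_continuous.
  rewrite (cintegralB _ _ ftc (cpath_cst (f z0))) cintegral_cst //.
  have -> : cintegral 0 (2 * pi) (fun y => f (t y)) = f 0 * cplx (2 * pi).
    exact: (@mean_value f 0 x (entire_continuous fd) (fun z _ => fd z)).
  by rewrite subr0; ring.
have SE N : S N.+1 = S 1.
  elim: N => // N <-; apply/eqP; rewrite eq_sym -subr_eq0 SS.
  have negp h : entire h -> (forall z, modulus z = 1 -> (h z)^* = h z) ->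
      cintegral 0 (2 * pi) (fun y => (t y ^+ N.+1)^-1 * h (t y)) = 0.
    by move=> hd hr; exact: (@mean_negpower h N x hd hr).
  have tNc : cpath (fun y => (t y ^+ N.+1)^-1).
    by apply: (cpathV (g := fun y => t y ^+ N.+1)) (cpathX _ tc) => y; rewrite expf_neq0 ?t0.
  have ftc : cpath (fun y => (t y ^+ N.+1)^-1 * f (t y)).
    apply: cpathM tNc _.
    by apply: (cpath_comp (f := f) _ tc) => y; exact: entire_continuous.
  (* The constant 1 is entire and real on the circle too, which kills the part of the term that
     carries f z0. *)
  have e1 : entire (fun=> 1 : C) by move=> z; exact: derivable_cst.
  have n1 := negp _ e1 (fun z _ => conjC1 C); have nf := negp _ fd freal.
  have k1c : cpath (fun y => (t y ^+ N.+1)^-1 * 1) by exact: cpathM tNc (cpath_cst _).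
  have -> : cintegral 0 (2 * pi) (fun y => (z0 / t y) ^+ N.+1 * (f (t y) - f z0)) =
      cintegral 0 (2 * pi) (fun y => z0 ^+ N.+1 * ((t y ^+ N.+1)^-1 * f (t y)) -
        z0 ^+ N.+1 * f z0 * ((t y ^+ N.+1)^-1 * 1)).
    by apply: eq_cintegral => y _; rewrite expr_div_n; ring.
  rewrite (cintegralB _ _ (cpathM (cpath_cst _) ftc) (cpathM (cpath_cst _) k1c)).
  by rewrite (cintegralZ _ _ _ ftc) (cintegralZ _ _ _ k1c) n1 nf !mulr0 subrr.
have [M M0 MP] := cpath_bounded tau_ge0 Dc.
pose rho := modulus z0 / (modulus z0 + 1).
have rho0 : 0 <= rho by rewrite divr_ge0 ?modulus_ge0 // ltW.
have Sle N : modulus (S N) <= 2 * (rho ^+ N * M) * (2 * pi).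
  have := @cintegral_bound _ _ _ _ (rho ^+ N * M) (Sc N) tau_ge0.
  rewrite subr0; apply => y y01; rewrite modulusM modulusX modulusM modulusV mt.
  by rewrite ler_wpM2l ?MP // exprn_ge0.
have S10 : S 1 = 0.
  apply/eqP; rewrite -modulus_eq0 eq_le modulus_ge0 andbT.
  apply/ler_addgt0Pr => e e0; rewrite add0r.
  have : (fun k => geometric (2 * M * (2 * pi)) rho k) @ \oo --> (0 : R).
    apply: cvg_geometric; rewrite ger0_norm // ltr_pdivrMr // mul1r.
    by rewrite ltrDl.
  move/cvgrPdist_lt => /(_ _ e0)[k _ /(_ k.+1 (leqnSn k))] /=.
  rewrite sub0r normrN => ke; rewrite -(SE k) (le_trans (Sle _)) //.
  apply: le_trans (ltW ke); rewrite /geometric /=.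
  by rewrite (_ : _ * (2 * pi) = 2 * M * (2 * pi) * rho ^+ k.+1) ?ler_norm //; ring.
move: S10; rewrite S1 => /eqP; rewrite mulf_eq0 => /orP[|].
  by rewrite subr_eq0 => /eqP.
rewrite cplx_eq0 => /eqP p0; have := pi_gt0 R.
by rewrite -(pmulr_rgt0 _ (ltr0Sn R 1)) p0 ltxx.
Qed.

End RealOnCircle.

(** * Cauchy transforms on the unit circle *)

Section CircleIntegrals.
Variable R : realType.
Local Notation C := (C_of R).
Implicit Types (z w : C) (x y e : R) (f g nu : C -> C).

Let tau_ge0 : 0 <= 2 * pi :> R.
Proof. by rewrite mulr_ge0 // pi_ge0. Qed.

Definition circ_mean (u : R -> C) : C := (cplx (2 * pi))^-1 * cintegral 0 (2 * pi) u.

Lemma circ_meanD (u v : R -> C) : cpath u -> cpath v ->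
  circ_mean (fun x => u x + v x) = circ_mean u + circ_mean v.
Proof. by move=> uc vc; rewrite /circ_mean (cintegralD _ _ uc vc) mulrDr. Qed.

Lemma circ_meanB (u v : R -> C) : cpath u -> cpath v ->
  circ_mean (fun x => u x - v x) = circ_mean u - circ_mean v.
Proof. by move=> uc vc; rewrite /circ_mean (cintegralB _ _ uc vc) mulrBr. Qed.

Lemma circ_meanZ (k : C) (u : R -> C) : cpath u ->
  circ_mean (fun x => k * u x) = k * circ_mean u.
Proof. by move=> uc; rewrite /circ_mean (cintegralZ _ _ _ uc) mulrCA. Qed.

Lemma eq_circ_mean (u v : R -> C) : u =1 v -> circ_mean u = circ_mean v.
Proof. by move=> uv; congr (_ * _); apply: eq_cintegral => x _; exact: uv. Qed.

Lemma circ_mean_bound (u : R -> C) (M : R) : cpath u ->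
  (forall x, 0 <= x <= 2 * pi -> modulus (u x) <= M) ->
  modulus (circ_mean u) <= 2 * M.
Proof.
move=> uc uM; rewrite /circ_mean modulusM modulusV modulus_cplx ger0_norm //.
rewrite mulrC ler_pdivrMr ?mulr_gt0 ?pi_gt0 //.
by have := cintegral_bound uc tau_ge0 uM; rewrite subr0.
Qed.

Lemma expi_subr_neq0 z x : modulus z != 1 -> expi x - z != 0.
Proof.
rewrite subr_eq0; apply: contra => /eqP <-.
by rewrite modulus_expi.
Qed.

Lemma le_dist_circle z x : `|1 - modulus z| <= modulus (expi x - z).
Proof.
have h1 := le_modulus_dist (expi x) z; have h2 := le_modulus_dist z (expi x).
rewrite modulus_expi in h1 h2; rewrite modulusB in h2.
by rewrite ler_norml h1 andbT lerNl opprB.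
Qed.

(** The contour integral 1/(2 pi i) int u(t) / (t - z) dt, except that the factor t of dt = i t d
    theta has to be part of [u]. *)
Definition cauchy_mean (u : R -> C) z : C := circ_mean (fun x => u x / (expi x - z)).

Lemma cpath_cauchy (u : R -> C) z : cpath u -> modulus z != 1 ->
  cpath (fun x => u x / (expi x - z)).
Proof.
move=> uc z1; apply: cpathM uc (cpathV _ (cpathB (cpath_expi R) (cpath_cst z))).
by move=> x; exact: expi_subr_neq0.
Qed.

(** Differentiation under the integral sign, with the explicit remainder u(t) (w - z)^2 / ((t - w)
    (t - z)^2). *)
Lemma cderiv_cauchy (u : R -> C) z : cpath u -> modulus z != 1 ->
  is_derive z 1 (cauchy_mean u) (circ_mean (fun x => u x / (expi x - z) ^+ 2)).
Proof.
move=> uc z1; apply/cderivP => e e0.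
have [K K0 uK] := cpath_bounded tau_ge0 uc.
pose r := `|1 - modulus z|.
have r0 : 0 < r by rewrite normr_gt0 subr_eq0 eq_sym.
(* On the circle |t - z| >= r and |t - w| >= r / 2, so the remainder is at most 2 K / r^3 |w - z|^2;
   [circ_mean_bound] doubles this, and K + 1 is positive even for K = 0. *)
have k0 : 0 < 4 * (K + 1) / r ^+ 3.
  by rewrite divr_gt0 ?exprn_gt0 // mulr_gt0 // ltr_wpDl.
exists (Num.min (r / 2) (e / (4 * (K + 1) / r ^+ 3))).
  by rewrite lt_min (divr_gt0 r0) // (divr_gt0 e0).
move=> w; rewrite lt_min => /andP[wr we].
have tw x : r / 2 <= modulus (expi x - w).
  have -> : expi x - w = (expi x - z) - (w - z) by ring.
  have h1 := le_modulus_dist (expi x - z) (w - z).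
  have h2 := le_dist_circle z x; rewrite -/r in h2; lra.
have tw0 x : expi x - w != 0.
  by rewrite -modulus_gt0 (lt_le_trans _ (tw x)) // divr_gt0.
have w1 : modulus w != 1.
  apply/eqP => w1; have := le_dist_circle z 0; rewrite -/r.
  have h1 := le_modulus_dist w z; have h2 := le_modulus_dist z w.
  rewrite w1 in h1 h2; rewrite modulusB in h2.
  have : r <= modulus (w - z) by rewrite /r ler_norml h1 andbT lerNl opprB.
  lra.
have cw := cpath_cauchy uc w1; have cz := cpath_cauchy uc z1.
have cz2 : cpath (fun x => u x / (expi x - z) ^+ 2).
  apply: cpathM uc (cpathV _ (cpathX 2 (cpathB (cpath_expi R) (cpath_cst z)))).
  by move=> x; rewrite expf_neq0 // expi_subr_neq0.
rewrite /cauchy_mean mulrC -(circ_meanB cw cz) -(circ_meanZ _ cz2).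
rewrite -(circ_meanB (cpathB cw cz) (cpathM (cpath_cst (w - z)) cz2)).
have k1 : 0 <= 2 * (K + 1) / r ^+ 3 * modulus (w - z) ^+ 2.
  by rewrite mulr_ge0 ?sqr_ge0 // ltW // divr_gt0 ?exprn_gt0 // mulr_gt0 // ltr_wpDl.
apply: le_trans (circ_mean_bound (M := 2 * (K + 1) / r ^+ 3 * modulus (w - z) ^+ 2) _ _) _.
- exact: cpathB (cpathB cw cz) (cpathM (cpath_cst (w - z)) cz2).
- move=> x x01; have tz0 := expi_subr_neq0 x z1.
  have -> : u x / (expi x - w) - u x / (expi x - z) -
      (w - z) * (u x / (expi x - z) ^+ 2) =
      u x * ((expi x - w)^-1 * (expi x - z)^-1 ^+ 2) * (w - z) ^+ 2.
    by field; rewrite tz0 tw0.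
  rewrite [modulus (_ * _ ^+ 2)]modulusM modulusX ler_wpM2r ?sqr_ge0 //.
  rewrite modulusM.
  have -> : 2 * (K + 1) / r ^+ 3 = (K + 1) * ((r / 2)^-1 * r^-1 ^+ 2).
    by field; rewrite gt_eqF.
  apply: ler_pM; rewrite ?modulus_ge0 //.
    by rewrite (le_trans (uK x x01)) // lerDl.
  rewrite modulusM modulusX !modulusV.
  apply: ler_pM; rewrite ?exprn_ge0 ?invr_ge0 ?modulus_ge0 //.
    by rewrite lef_pV2 // ?posrE ?modulus_gt0 ?divr_gt0.
  rewrite lerXn2r ?nnegrE ?invr_ge0 ?modulus_ge0 ?(ltW r0) //.
  by rewrite lef_pV2 ?posrE ?modulus_gt0 // le_dist_circle.
have -> : 2 * (2 * (K + 1) / r ^+ 3 * modulus (w - z) ^+ 2) =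
  modulus (w - z) * (4 * (K + 1) / r ^+ 3) * modulus (w - z) by ring.
rewrite ler_wpM2r ?modulus_ge0 //.
by move: we; rewrite ltr_pdivlMr // => /ltW.
Qed.

(** This is t / (t - z) = 1 + z / (t - z). *)
Lemma cauchy_shift (u : R -> C) z : cpath u -> modulus z != 1 ->
  cauchy_mean (fun x => expi x * u x) z = circ_mean u + z * cauchy_mean u z.
Proof.
move=> uc z1; have cz := cpath_cauchy uc z1.
rewrite /cauchy_mean -(circ_meanZ _ cz) -(circ_meanD uc (cpathM (cpath_cst z) cz)).
apply: eq_circ_mean => x; have tz := expi_subr_neq0 x z1.
by field.
Qed.

Lemma cauchyD (u v : R -> C) z : cpath u -> cpath v -> modulus z != 1 ->
  cauchy_mean (fun x => u x + v x) z = cauchy_mean u z + cauchy_mean v z.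
Proof.
move=> uc vc z1; have uz := cpath_cauchy uc z1; have vz := cpath_cauchy vc z1.
rewrite /cauchy_mean -(circ_meanD uz vz).
by apply: eq_circ_mean => x; rewrite mulrDl.
Qed.

Lemma cauchyZ (k : C) (u : R -> C) z : cpath u -> modulus z != 1 ->
  cauchy_mean (fun x => k * u x) z = k * cauchy_mean u z.
Proof.
move=> uc z1; rewrite /cauchy_mean -(circ_meanZ _ (cpath_cauchy uc z1)).
by apply: eq_circ_mean => x; rewrite mulrA.
Qed.

Lemma eq_cauchy (u v : R -> C) z : u =1 v -> cauchy_mean u z = cauchy_mean v z.
Proof. by move=> uv; apply: eq_circ_mean => x; rewrite uv. Qed.

(** Horner recursion: each multiplication by t goes through [cauchy_shift] and adds a moment to the
    coefficients of [r]. Moments do not see z, so one [r] is valid inside and outside the circle. *)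
Lemma cauchy_poly (v : R -> C) (p : {poly C}) : cpath v ->
  exists r : {poly C}, forall z, modulus z != 1 ->
    cauchy_mean (fun x => p.[expi x] * v x) z = p.[z] * cauchy_mean v z + r.[z].
Proof.
move=> vc; elim/poly_ind: p => [|p c [r rP]].
  exists 0 => z z1; rewrite !horner0 mul0r addr0 -(mul0r (cauchy_mean v z)).
  by rewrite -(cauchyZ _ vc z1); apply: eq_cauchy => x; rewrite horner0.
have pc : cpath (fun x => p.[expi x] * v x).
  exact: cpathM (cpath_horner _ (cpath_expi R)) vc.
exists (r * 'X + (circ_mean (fun x => p.[expi x] * v x))%:P) => z z1.
rewrite !hornerMXaddC.
have -> : (p.[z] * z + c) * cauchy_mean v z +
    (r.[z] * z + circ_mean (fun x => p.[expi x] * v x)) =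
    circ_mean (fun x => p.[expi x] * v x) +
    z * (p.[z] * cauchy_mean v z + r.[z]) + c * cauchy_mean v z by ring.
rewrite -rP // -(cauchy_shift pc z1) -(cauchyZ _ vc z1).
rewrite -(cauchyD (cpathM (cpath_expi R) pc) (cpathM (cpath_cst c) vc) z1).
by apply: eq_cauchy => x; rewrite hornerMXaddC; ring.
Qed.

(** Each use of [cauchy_shift] costs one moment; as long as the moments vanish, powers of z move
    under the integral. Thus n vanishing moments yield decay like |z|^-(n+1). *)
Lemma cauchy_expi_exp (u : R -> C) z n : cpath u -> modulus z != 1 ->
  (forall k, (k < n)%N -> circ_mean (fun x => expi x ^+ k * u x) = 0) ->
  z ^+ n * cauchy_mean u z = cauchy_mean (fun x => expi x ^+ n * u x) z.
Proof.
move=> uc z1; elim: n => [_|n IH u0].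
  by rewrite mul1r; apply: eq_cauchy => x; rewrite expr0 mul1r.
have nc : cpath (fun x => expi x ^+ n * u x).
  exact: cpathM (cpathX n (cpath_expi R)) uc.
rewrite exprS -mulrA IH => [|k kn]; last by apply: u0; exact: ltnW.
rewrite -[LHS]add0r -(u0 n (ltnSn n)) -(cauchy_shift nc z1).
by apply: eq_cauchy => x; rewrite exprS mulrA.
Qed.

Lemma cauchy_decay (u : R -> C) : cpath u -> exists2 A : R, 0 <= A &
  forall z, 2 <= modulus z -> modulus (cauchy_mean u z) <= A / modulus z.
Proof.
move=> uc; have [K K0 uK] := cpath_bounded tau_ge0 uc.
exists (4 * K) => [|z z2]; first by rewrite mulr_ge0.
have z1 : modulus z != 1 by rewrite gt_eqF // (lt_le_trans _ z2) // ltr1n.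
have z0 : 0 < modulus z by rewrite (lt_le_trans _ z2).
have -> : 4 * K / modulus z = 2 * (K * (2 / modulus z)).
  by field; rewrite gt_eqF.
apply: circ_mean_bound; first exact: cpath_cauchy.
move=> x x01; rewrite modulusM modulusV ler_pM ?invr_ge0 ?modulus_ge0 ?uK //.
have h : modulus z / 2 <= modulus (expi x - z).
  by have := le_modulus_dist z (expi x); rewrite modulus_expi modulusB; lra.
rewrite -[2 / _]invf_div lef_pV2 ?posrE ?divr_gt0 //.
by rewrite (lt_le_trans _ h) ?divr_gt0.
Qed.

Lemma modulus_sum n (F : 'I_n -> C) :
  modulus (\sum_i F i) <= \sum_i modulus (F i).
Proof.
elim/big_rec2: _ => [|i y x _ h]; first by rewrite modulus0.
by rewrite (le_trans (le_modulusD _ _)) // lerD2l.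
Qed.

Lemma poly_growth (p : {poly C}) m : (size p <= m.+1)%N ->
  exists2 A : R, 0 <= A &
    forall z, 1 <= modulus z -> modulus p.[z] <= A * modulus z ^+ m.
Proof.
move=> pm; exists (\sum_(i < m.+1) modulus p`_i).
  by apply: sumr_ge0 => i _; exact: modulus_ge0.
move=> z z1; rewrite (horner_coef_wide _ pm) mulr_suml.
apply: le_trans (modulus_sum _) _; apply: ler_sum => i _.
rewrite modulusM modulusX ler_wpM2l ?modulus_ge0 //.
by rewrite ler_weXn2l // -ltnS.
Qed.

(** Liouville's theorem for polynomials, by induction on the size: the quotient of p by X obeys a
    bound of the same kind. *)
Lemma poly_decay_eq0 (p : {poly C}) (A : R) :
  (forall z, 2 <= modulus z -> modulus p.[z] <= A / modulus z) -> p = 0.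
Proof.
have [n] := ubnP (size p); elim: n p A => // n IH p A pn pA.
have [q [c pE]] : exists q c, p = q * 'X + c%:P.
  by elim/poly_ind: p {pn pA} => [|q c _]; [exists 0, 0; rewrite mul0r add0r polyC0|exists q, c].
have [->//|p0] := eqVneq p 0.
have q0 : q = 0.
  (* Here |q z| = |p - c| <= A / |z| + |c|, and |z| >= 2. *)
  apply: (IH q (A / 2 + modulus c)).
    have := size_MXaddC q c; rewrite -pE => sp.
    by move: p0 pn; rewrite -size_poly_eq0 sp; case: ifP.
  move=> z z2; have z0 : 0 < modulus z by rewrite (lt_le_trans _ z2).
  rewrite ler_pdivlMr // -modulusM.
  have -> : q.[z] * z = p.[z] - c by rewrite pE hornerMXaddC addrK.
  rewrite (le_trans (le_modulusB _ _)) // lerD2r (le_trans (pA z z2)) //.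
  have A0 : 0 <= A.
    by have := le_trans (modulus_ge0 _) (pA z z2); rewrite pmulr_lge0 // invr_gt0.
  by rewrite ler_wpM2l // lef_pV2 ?posrE.
have pc z : p.[z] = c by rewrite pE q0 mul0r add0r hornerC.
have c0 : c = 0.
  apply/eqP; rewrite -modulus_eq0; apply/negPn/negP => cN0.
  have cp : 0 < modulus c by rewrite lt_def cN0 modulus_ge0.
  (* At the real point [M] the decay would give |A| + 2 |c| <= A. *)
  pose M := `|A| / modulus c + 2.
  have M2 : 2 <= M by rewrite lerDr divr_ge0 // modulus_ge0.
  have M0 : 0 < M by rewrite (lt_le_trans _ M2).
  have := pA (cplx M); rewrite modulus_cplx gtr0_norm // => /(_ M2).
  rewrite pc ler_pdivlMr // /M mulrDr mulrC divfK // => h.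
  have := le_trans h (ler_norm A); rewrite gerDl.
  by rewrite leNgt mulr_gt0.
by rewrite pE q0 c0 mul0r add0r polyC0.
Qed.

End CircleIntegrals.

(** * The weight with constant H and the equation of its Cauchy transform *)

Section Weight.
Variables (R : realType) (l : R) (k : C_of R).
Local Notation C := (C_of R).
Implicit Types (z w : C) (x y : R).

Let nu : C -> C := weight l (fun=> k).

Lemma cderiv_weight z : z != 0 ->
  is_derive z 1 nu (nu z * (cplx l / 2 * (1 - z ^- 2))).
Proof.
move=> z0; pose h w : C := cplx l * (w + w^-1) / 2.
have hd : is_derive z 1 h (cplx l / 2 * (1 - z ^- 2)).
  apply: is_derive_eq (cderivM (cderivM (cderiv_cst (cplx l) z)
    (cderivD (cderiv_id z) (cderivV z0 (cderiv_id z)))) (cderiv_cst 2^-1 z)) _.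
  by field.
apply: is_derive_eq (cderivM (cderiv_comp (is_derive_cexp (h z)) hd) (cderiv_cst k z)) _.
by rewrite /nu /weight -/(h z); ring.
Qed.

Lemma cpath_weight : cpath (fun x => nu (expi x)).
Proof.
apply: (cpath_comp (f := nu) _ (cpath_expi R)) => x.
exact: is_derive_continuous (cderiv_weight (expi_neq0 x)).
Qed.

(** This is nu(t) t^-n together with the factor t of dt = i t d theta. *)
Definition kernel_weight n x : C := nu (expi x) * (expi x / expi x ^+ n).

Lemma cpath_expiV n : cpath (fun x => (expi x ^+ n)^-1 : C).
Proof.
apply: (cpathV (g := fun x => expi x ^+ n)) (cpathX n (cpath_expi R)) => x.
by rewrite expf_neq0 ?expi_neq0.
Qed.

Lemma cpath_kernel_weight n : cpath (kernel_weight n).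
Proof. exact: cpathM cpath_weight (cpathM (cpath_expi R) (cpath_expiV n)). Qed.

(** z^2 times the logarithmic derivative of z^-n nu(z); the factor z^2 clears the pole coming from
    the exponent l (z + 1/z) / 2. *)
Definition weight_poly n : {poly C} :=
  (cplx l / 2) *: ('X^2 - 1) - n%:R *: 'X.

Lemma horner_weight_poly n z :
  (weight_poly n).[z] = cplx l / 2 * (z ^+ 2 - 1) - n%:R * z.
Proof. by rewrite /weight_poly !hornerE. Qed.

(* Integration by parts: the derivative of [t^-n nu(t) / (t - z)] along the
   circle integrates to zero. *)
Lemma kernel_weight_parts n z : modulus z != 1 ->
  circ_mean (fun x => kernel_weight n x / (expi x - z) ^+ 2) =
  circ_mean (fun x => (weight_poly n).[expi x] / expi x ^+ 2 *
    kernel_weight n x / (expi x - z)).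
Proof.
move=> z1.
have sc : cpath (fun x => (weight_poly n).[expi x] / expi x ^+ 2).
  exact: cpathM (cpath_horner _ (cpath_expi R)) (cpath_expiV 2).
have ac : cpath (fun x => (weight_poly n).[expi x] / expi x ^+ 2 *
    kernel_weight n x / (expi x - z)).
  by apply: cpath_cauchy z1; exact: cpathM sc (cpath_kernel_weight n).
have bc : cpath (fun x => kernel_weight n x / (expi x - z) ^+ 2).
  apply: cpathM (cpath_kernel_weight n) (cpathV _ (cpathX 2 (cpathB (cpath_expi R) (cpath_cst z)))).
  by move=> x; rewrite expf_neq0 // expi_subr_neq0.
apply/eqP; rewrite eq_sym -subr_eq0 -(circ_meanB ac bc).
have i0 : 'i%C != 0 :> C by rewrite -modulus_eq0 modulus_i oner_eq0.
(* Multiplied by i, the integrand becomes an exact derivative in theta along the closed path. *)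
rewrite -(mulrI_eq0 _ (mulfI i0)) -(circ_meanZ _ (cpathB ac bc)) /circ_mean.
rewrite mulf_eq0; apply/orP; right.
pose F w := nu w * (w ^+ n)^-1 * (w - z)^-1.
rewrite (@cintegral_FTC _ _ _ (fun x => F (expi x))).
- by rewrite expi_2pi subrr.
- by rewrite mulr_ge0 // pi_ge0.
- exact: cpathM (cpath_cst _) (cpathB ac bc).
move=> x; have tz := expi_subr_neq0 x z1; have t0 := expi_neq0 x.
have tn : expi x ^+ n != 0 by rewrite expf_neq0.
have := rderiv_comp (f := F) (cderivM (cderivM (cderiv_weight t0)
  (cderivV (f := fun w => w ^+ n) tn (cderivX n (cderiv_id _))))
  (cderivV (f := fun w => w - z) tz (cderivB (cderiv_id _) (cderiv_cst z _)))) (rderiv_expi x).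
congr (rderiv _ _ _); rewrite horner_weight_poly /kernel_weight.
(* For n = 0 the truncated exponent n.-1 is masked by the coefficient 0, so the formula is uniform
   in n. *)
have -> : n%:R * expi x ^+ n.-1 = n%:R * expi x ^+ n / expi x :> C.
  case: (n) => [|m] /=; first by rewrite !mul0r.
  by rewrite exprS; field.
by field; rewrite t0 tn tz.
Qed.

(** After integration by parts, z^2 / (t^2 (t - z)) = 1 / (t - z) - 1 / t - z / t^2 removes the
    division by t^2 at the price of the moments [a] and [b]; [cauchy_poly] then takes the polynomial
    out of the integral. *)
Lemma cauchy_kernel_ode n : exists e : {poly C}, forall z, modulus z != 1 ->
  exists2 d : C, is_derive z 1 (cauchy_mean (kernel_weight n)) d &
    z ^+ 2 * d = (weight_poly n).[z] * cauchy_mean (kernel_weight n) z + e.[z].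
Proof.
set v := kernel_weight n; set s := weight_poly n.
have vc : cpath v := cpath_kernel_weight n.
have [r rP] := cauchy_poly s vc.
have sc : cpath (fun x => s.[expi x] * v x) by exact: cpathM (cpath_horner _ (cpath_expi R)) vc.
have s1c : cpath (fun x => (expi x ^+ 1)^-1 * (s.[expi x] * v x)) by exact: cpathM (cpath_expiV 1) sc.
have s2c : cpath (fun x => (expi x ^+ 2)^-1 * (s.[expi x] * v x)) by exact: cpathM (cpath_expiV 2) sc.
pose a := circ_mean (fun x => (expi x ^+ 1)^-1 * (s.[expi x] * v x)).
pose b := circ_mean (fun x => (expi x ^+ 2)^-1 * (s.[expi x] * v x)).
exists (r - a%:P - b *: 'X) => z z1.
exists (circ_mean (fun x => v x / (expi x - z) ^+ 2)); first exact: cderiv_cauchy.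
rewrite kernel_weight_parts // -/v -/s.
have -> : s.[z] * cauchy_mean v z + (r - a%:P - b *: 'X).[z] =
    cauchy_mean (fun x => s.[expi x] * v x) z - a - z * b.
  have -> : (r - a%:P - b *: 'X).[z] = r.[z] - a - z * b.
    by clearbody a b; rewrite !hornerE (mulrC b).
  by rewrite rP // !addrA.
have c1 := cpath_cauchy sc z1; have c2 := cpathM (cpath_cst z) s2c.
have c3 := cpath_cauchy s2c z1.
rewrite /cauchy_mean -(circ_meanZ _ s2c) -(circ_meanB c1 s1c) -(circ_meanB (cpathB c1 s1c) c2).
rewrite -(circ_meanZ (z ^+ 2)).
  apply: eq_circ_mean => x; have tz := expi_subr_neq0 x z1; have t0 := expi_neq0 x.
  by field; rewrite tz t0.
apply: cpath_cauchy z1; apply: cpathM vc.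
exact: cpathM (cpath_horner _ (cpath_expi R)) (cpath_expiV 2).
Qed.

End Weight.

(** * Orthogonality and decay at infinity *)

Section Orthogonality.
Variables (R : realType) (l : R) (k : C_of R).
Local Notation C := (C_of R).
Implicit Types (z w : C) (x y : R).

(** The scalar map [f] is the identity for a linear functional and conjugation for a
    conjugate-linear one, so both slots of [pairing] are covered. Subtracting a multiple of [Phi m]
    lowers the size bound. *)
Lemma monic_basis_eq0 (Phi : nat -> {poly C}) (V : {poly C} -> C) (f : C -> C) m :
  (forall j, Phi j \is monic /\ size (Phi j) = j.+1) ->
  (forall p q, V (p + q) = V p + V q) ->
  (forall a p, V (a *: p) = f a * V p) ->
  (forall j, (j < m)%N -> V (Phi j) = 0) ->
  forall p : {poly C}, (size p <= m)%N -> V p = 0.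
Proof.
move=> Phi_monic VD VZ; elim: m => [|m IH] V0 p pm.
  move: pm; rewrite leqn0 size_poly_eq0 => /eqP ->.
  by have /eqP := VD 0 0; rewrite addr0 -subr_eq0 opprD addNKr oppr_eq0 => /eqP.
have [/monicP lc sz] := Phi_monic m; rewrite lead_coefE sz /= in lc.
rewrite -(subrK (p`_m *: Phi m) p) VD VZ V0 // mulr0 addr0.
apply: IH => [j jm|]; first by apply: V0; exact: ltnW.
apply/leq_sizeP => j; rewrite leq_eqVlt => /orP[/eqP <-|mj].
  by rewrite coefB coefZ lc mulr1 subrr.
rewrite coefB coefZ (leq_sizeP _ _ pm _ mj).
by rewrite (leq_sizeP _ _ (eq_leq sz) _ mj) mulr0 subrr.
Qed.

Lemma size_monic_subXn (p : {poly C}) m : p \is monic -> size p = m.+1 ->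
  (size (p - 'X^m)%R <= m)%N.
Proof.
move=> /monicP lc sz; rewrite lead_coefE sz /= in lc.
apply/leq_sizeP => j; rewrite leq_eqVlt coefB coefXn => /orP[/eqP <-|mj].
  by rewrite eqxx lc subrr.
by rewrite gtn_eqF // (leq_sizeP _ _ (eq_leq sz) _ mj) subrr.
Qed.

Let nu : C -> C := weight l (fun=> k).

Variables (Phi : nat -> {poly C}) (kappa : nat -> R).
Hypothesis OPUC : is_monic_OPUC nu Phi kappa.

Let Phi_monic j : Phi j \is monic /\ size (Phi j) = j.+1.
Proof. by have [] := OPUC. Qed.

Let kappa_gt0 j : 0 < kappa j. Proof. by have [] := OPUC. Qed.

(** The inner product of L^2(mu) divided by 2 pi, so that the squared norm of [Phi i] is 1 / b_i. *)
Definition pairing (p q : {poly C}) : C :=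
  circ_mean (fun x => p.[expi x] * (q.[expi x])^* * nu (expi x)).

Let cpath_pairing (p q : {poly C}) :
  cpath (fun x => p.[expi x] * (q.[expi x])^* * nu (expi x)).
Proof.
have e := cpath_expi R.
exact: cpathM (cpathM (cpath_horner p e) (cpath_conj (cpath_horner q e))) (cpath_weight l k).
Qed.

Lemma pairingE i j : pairing (Phi i) (Phi j) = if i == j then (bcoef kappa i)^-1 else 0.
Proof.
have [_ _ /(_ i j)] := OPUC; rewrite /mu_integral /circle_integral.
rewrite (@eq_cintegral _ _ _ _
    (fun x => (Phi i).[expi x] * ((Phi j).[expi x])^* * nu (expi x))); last first.
  move=> x _.
  have i0 : 'i%C != 0 :> C by rewrite -modulus_eq0 modulus_i oner_eq0.
  by field; rewrite i0 expi_neq0.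
rewrite /pairing /circ_mean => ->; case: eqP => // _; last by rewrite mulr0.
by rewrite /bcoef -!cplxV -cplxM (invfM (2 * pi)).
Qed.

Lemma pairing_left (p : {poly C}) m : (size p <= m)%N -> pairing p (Phi m) = 0.
Proof.
apply: (monic_basis_eq0 (V := fun p => pairing p (Phi m)) (f := id) Phi_monic).
- move=> p1 p2; rewrite /pairing -(circ_meanD (cpath_pairing _ _) (cpath_pairing _ _)).
  by apply: eq_circ_mean => x; rewrite hornerD; ring.
- move=> a p1; rewrite /pairing -(circ_meanZ _ (cpath_pairing _ _)).
  by apply: eq_circ_mean => x; rewrite hornerZ; ring.
- by move=> j jm; rewrite pairingE ltn_eqF.
Qed.

Lemma pairing_right (p : {poly C}) m : (size p <= m)%N -> pairing (Phi m) p = 0.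
Proof.
apply: (monic_basis_eq0 (V := fun p => pairing (Phi m) p) (f := fun a => a^*) Phi_monic).
- move=> p1 p2; rewrite /pairing -(circ_meanD (cpath_pairing _ _) (cpath_pairing _ _)).
  by apply: eq_circ_mean => x; rewrite hornerD rmorphD; ring.
- move=> a p1; rewrite /pairing -(circ_meanZ _ (cpath_pairing _ _)).
  by apply: eq_circ_mean => x; rewrite hornerZ rmorphM; ring.
- by move=> j jm; rewrite pairingE gtn_eqF.
Qed.

Lemma pairing_Xn m : pairing 'X^m (Phi m) = (bcoef kappa m)^-1.
Proof.
have [Pm sz] := Phi_monic m.
have h : (size ('X^m - Phi m : {poly C})%R <= m)%N.
  by rewrite -opprB size_polyN size_monic_subXn.
rewrite -[(bcoef _ _)^-1]add0r -(pairing_left h).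
have := pairingE m m; rewrite eqxx => <-.
rewrite /pairing -(circ_meanD (cpath_pairing _ _) (cpath_pairing _ _)).
by apply: eq_circ_mean => x; rewrite hornerD hornerN; ring.
Qed.

Lemma bcoef_neq0 m : bcoef kappa m != 0.
Proof.
by rewrite /bcoef cplx_eq0 !mulf_neq0 ?pnatr_eq0 ?lt0r_neq0 ?pi_gt0 ?exprn_gt0
  ?kappa_gt0.
Qed.

Let circ_prefactor (u : R -> C) : cpath u ->
  (cplx (2 * pi) * 'i%C)^-1 * cintegral 0 (2 * pi) (fun x => 'i%C * u x) = circ_mean u.
Proof.
move=> uc; rewrite (cintegralZ _ _ _ uc) /circ_mean.
have i0 : 'i%C != 0 :> C by rewrite -modulus_eq0 modulus_i oner_eq0.
by rewrite invfM -mulrA (mulKf i0).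
Qed.

Lemma G_funE n z : modulus z != 1 -> G_fun nu Phi n z =
  cauchy_mean (fun x => (Phi n).[expi x] * kernel_weight l k n x) z.
Proof.
move=> z1; rewrite /cauchy_mean -circ_prefactor; last first.
  apply: cpath_cauchy z1.
  exact: cpathM (cpath_horner _ (cpath_expi R)) (cpath_kernel_weight _ _ _).
congr (_ * _); apply: eq_cintegral => x _; rewrite /kernel_weight -/nu.
by ring.
Qed.

(** An actual polynomial that agrees with [reversed] off 0 and has the proper value at 0, where the
    pole is studied. *)
Definition star_poly m (p : {poly C}) : {poly C} :=
  \sum_(i < m.+1) (p`_i)^* *: 'X^(m - i).

Lemma size_star_poly m (p : {poly C}) : (size (star_poly m p) <= m.+1)%N.
Proof.
apply: leq_trans (size_sum _ _ _) _; apply/bigmax_leqP => i _.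
by rewrite (leq_trans (size_scale_leq _ _)) // size_polyXn ltnS leq_subr.
Qed.

Lemma horner_star_poly m (p : {poly C}) z : (size p <= m.+1)%N -> z != 0 ->
  (star_poly m p).[z] = reversed m p z.
Proof.
move=> pm z0; rewrite /reversed /star_poly (horner_coef_wide _ pm) horner_sum rmorph_sum.
rewrite mulr_sumr; apply: eq_bigr => i _.
rewrite hornerZ hornerXn rmorphM rmorphXn fmorphV /= conjCK mulrCA; congr (_ * _).
by rewrite exprVn -exprB ?unitfE // -ltnS.
Qed.

Lemma reversed_expi m (p : {poly C}) x : reversed m p (expi x) = expi x ^+ m * (p.[expi x])^*.
Proof. by rewrite /reversed conj_expi invrK. Qed.

Lemma Gstar_predE n z : modulus z != 1 -> Gstar_pred nu Phi n.+1 z =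
  cauchy_mean (fun x => (star_poly n (Phi n)).[expi x] * kernel_weight l k n.+1 x) z.
Proof.
move=> z1; rewrite /cauchy_mean -circ_prefactor; last first.
  apply: cpath_cauchy z1.
  exact: cpathM (cpath_horner _ (cpath_expi R)) (cpath_kernel_weight _ _ _).
have [_ sz] := Phi_monic n.
congr (_ * _); apply: eq_cintegral => x _; rewrite /kernel_weight -/nu.
by rewrite horner_star_poly ?sz ?expi_neq0 //=; ring.
Qed.

Lemma G_fun_decay n : exists2 A : R, 0 <= A & forall z, 2 <= modulus z ->
  modulus (z ^+ n * G_fun nu Phi n z) <= A / modulus z.
Proof.
have uc : cpath (fun x => (Phi n).[expi x] * kernel_weight l k n x).
  exact: cpathM (cpath_horner _ (cpath_expi R)) (cpath_kernel_weight _ _ _).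
have [A A0 AP] := cauchy_decay (cpathM (cpathX n (cpath_expi R)) uc).
exists A => // z z2.
have z1 : modulus z != 1 by rewrite gt_eqF // (lt_le_trans _ z2) // ltr1n.
rewrite G_funE // (cauchy_expi_exp uc z1) ?AP // => j jn.
(* The kernel contains t^(1 - n), so the moment of index j pairs [Phi n] with t^(n - 1 - j), of
   degree less than n. *)
rewrite -(@pairing_right ('X^(n.-1 - j)) n); last first.
  by rewrite size_polyXn; case: n jn {uc A A0 AP} => // n _; rewrite ltnS leq_subr.
apply: eq_circ_mean => x; rewrite hornerXn rmorphXn /= conj_expi /kernel_weight -/nu.
case: n jn {uc A A0 AP} => // n jn /=; have t0 := expi_neq0 x.
have jE : expi x ^+ n.+1 = expi x ^+ (n - j) * expi x ^+ j * expi x.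
  by rewrite -exprD subnK // -exprSr.
rewrite jE exprVn; have tj : expi x ^+ j != 0 by rewrite expf_neq0.
have tn : expi x ^+ (n - j) != 0 by rewrite expf_neq0.
by field; rewrite t0 tj tn.
Qed.

(** On the circle the powers of t in the reversed polynomial and in the kernel cancel, so the moment
    of index j is the pairing of t^j with [Phi n]: zero for j < n and 1 / b_n for j = n. The latter
    gives the leading coefficient -1 / b_n at infinity. *)
Lemma Gstar_pred_decay n : exists2 A : R, 0 <= A & forall z, 2 <= modulus z ->
  modulus (z ^+ n.+1 * Gstar_pred nu Phi n.+1 z + (bcoef kappa n)^-1) <= A / modulus z.
Proof.
pose u x := (star_poly n (Phi n)).[expi x] * kernel_weight l k n.+1 x.
have uc : cpath u.
  exact: cpathM (cpath_horner _ (cpath_expi R)) (cpath_kernel_weight _ _ _).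
have [_ sz] := Phi_monic n.
have uE x : u x = ((Phi n).[expi x])^* * nu (expi x).
  have t0 := expi_neq0 x; have tn : expi x ^+ n != 0 :> C by rewrite expf_neq0.
  rewrite /u horner_star_poly ?sz // reversed_expi /kernel_weight -/nu exprS.
  by field; rewrite t0 tn.
have uX j : circ_mean (fun x => expi x ^+ j * u x) = pairing 'X^j (Phi n).
  by apply: eq_circ_mean => x; rewrite uE hornerXn mulrA.
have nc : cpath (fun x => expi x ^+ n * u x).
  exact: cpathM (cpathX n (cpath_expi R)) uc.
have [A A0 AP] := cauchy_decay (cpathM (cpath_expi R) nc).
exists A => // z z2.
have z1 : modulus z != 1 by rewrite gt_eqF // (lt_le_trans _ z2) // ltr1n.
rewrite Gstar_predE // -/u exprS -mulrA (cauchy_expi_exp uc z1) => [|j jn].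
  by rewrite addrC -pairing_Xn -uX -(cauchy_shift nc z1) AP.
by rewrite uX pairing_left // size_polyXn.
Qed.

End Orthogonality.

(** * The structure matrix *)

Section MatrixCalculus.
Variable R : realType.
Local Notation C := (C_of R).
Implicit Types (z w : C).

Lemma mx2P (A B : 'M[C]_2) : A 0 0 = B 0 0 -> A 0 1 = B 0 1 ->
  A 1 0 = B 1 0 -> A 1 1 = B 1 1 -> A = B.
Proof.
move=> h00 h01 h10 h11; apply/matrixP => i j.
have I2 (m : 'I_2) : m = 0 \/ m = 1.
  by case: m => [[|[|//]] Hm]; [left|right]; apply: val_inj.
by case: (I2 i) => ->; case: (I2 j) => ->.
Qed.

Lemma mulmx_mx2 (a b c d a' b' c' d' : C) :
  mx2 a b c d *m mx2 a' b' c' d' =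
  mx2 (a * a' + b * c') (a * b' + b * d') (c * a' + d * c') (c * b' + d * d').
Proof. by apply: mx2P; rewrite !mxE !big_ord_recl big_ord0 !mxE /= addr0. Qed.

Lemma scale_mx2 (x a b c d : C) :
  x *: mx2 a b c d = mx2 (x * a) (x * b) (x * c) (x * d).
Proof. by apply: mx2P; rewrite !mxE. Qed.

Lemma add_mx2 (a b c d a' b' c' d' : C) :
  mx2 a b c d + mx2 a' b' c' d' = mx2 (a + a') (b + b') (c + c') (d + d').
Proof. by apply: mx2P; rewrite !mxE. Qed.

Lemma opp_mx2 (a b c d : C) : - mx2 a b c d = mx2 (- a) (- b) (- c) (- d).
Proof. by apply: mx2P; rewrite !mxE. Qed.

Lemma unitmx_mx2 (a b c d : C) : a * d - b * c = 1 -> mx2 a b c d \in unitmx.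
Proof.
move=> det1; have [] // := @mulmx1_unit _ _ (mx2 a b c d) (mx2 d (- b) (- c) a).
rewrite mulmx_mx2; apply: mx2P; rewrite !mxE /= -det1; ring.
Qed.

Lemma cvg_mx2 {T : Type} {F : set_system T} {FF : Filter F}
    (a b c d : T -> C) (la lb lc ld : C) :
  a @ F --> la -> b @ F --> lb -> c @ F --> lc -> d @ F --> ld ->
  (fun x => mx2 (a x) (b x) (c x) (d x)) @ F --> mx2 la lb lc ld.
Proof.
(* A combination of four constant matrices reduces entrywise convergence to sums and scalar
   multiples. *)
have E (x y z w : C) : mx2 x y z w = x *: mx2 1 0 0 0 + y *: mx2 0 1 0 0 +
    z *: mx2 0 0 1 0 + w *: mx2 0 0 0 1.
  by rewrite !scale_mx2 !add_mx2 !mulr1 !mulr0 !addr0 !add0r.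
move=> ca cb cc cd.
have Z (f : T -> C) (lf : C) (A : 'M[C]_2) : f @ F --> lf -> f x *: A @[x --> F] --> lf *: A.
  by move=> fl; exact: (cvgZr_tmp (a := A) fl).
have h := cvgD (cvgD (cvgD (Z _ _ (mx2 1 0 0 0) ca) (Z _ _ (mx2 0 1 0 0) cb))
  (Z _ _ (mx2 0 0 1 0) cc)) (Z _ _ (mx2 0 0 0 1) cd).
rewrite E (_ : (fun x => _) = fun x => a x *: mx2 1 0 0 0 + b x *: mx2 0 1 0 0 +
    c x *: mx2 0 0 1 0 + d x *: mx2 0 0 0 1); last by apply: funext => x.
exact: h.
Qed.

Lemma is_derive_mx2 (a b c d : C -> C) z (da db dc dd : C) :
  is_derive z 1 a da -> is_derive z 1 b db -> is_derive z 1 c dc ->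
  is_derive z 1 d dd ->
  is_derive z 1 (fun w => mx2 (a w) (b w) (c w) (d w)) (mx2 da db dc dd).
Proof.
move=> [ad <-] [bd <-] [cd <-] [dd' <-].
set f := (fun w => mx2 _ _ _ _).
suff h : h^-1 *: ((f \o shift z) (h *: 1) - f z) @[h --> (0 : C)^'] -->
    mx2 ('D_1 a z) ('D_1 b z) ('D_1 c z) ('D_1 d z).
  by apply: DeriveDef; [apply/cvg_ex; eexists; exact: h|exact: cvg_lim h].
rewrite /f /=.
under eq_fun do rewrite opp_mx2 add_mx2 scale_mx2.
by apply: cvg_mx2; [exact: ad|exact: bd|exact: cd|exact: dd'].
Qed.

End MatrixCalculus.

(** * Local analytic branches of square roots *)

Section Branches.
Variable R : realType.
Local Notation C := (C_of R).
Implicit Types (v w z : C).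

Lemma Re_sqrtc_gt0 v : 0 < complex.Re v -> 0 < complex.Re (sqrtc v).
Proof.
case: v => a b /= a0; rewrite sqrtr_gt0 divr_gt0 // ltr_wpDl // sqrtr_ge0.
Qed.

(** With p and q the roots of v and v', q - p = (v' - v) / (q + p), where Re (q + p) >= Re p > 0
    keeps the denominator away from 0; the error of the linear approximation is -(q - p)^2 / (2
    p). *)
Lemma derivable_sqrtc v : 0 < complex.Re v -> derivable (@sqrtc R : C -> C) v 1.
Proof.
move=> v0; set p := sqrtc v; have rp := Re_sqrtc_gt0 v0; rewrite -/p in rp.
have p0 : 0 < modulus p by rewrite (lt_le_trans rp) // (le_trans (ler_norm _)) // le_Re_modulus.
have pN0 : p != 0 by rewrite -modulus_gt0.
suff [] : is_derive v 1 (@sqrtc R : C -> C) (2 * p)^-1 by [].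
apply/cderivP => e e0; set rho := complex.Re p in rp.
have c0 : 0 < rho ^+ 2 * (2 * modulus p) by rewrite mulr_gt0 ?exprn_gt0 // mulr_gt0.
exists (Num.min (complex.Re v) (e * (rho ^+ 2 * (2 * modulus p)))).
  by rewrite lt_min v0 mulr_gt0.
move=> v'; rewrite lt_min => /andP[vv ve].
have v'0 : 0 < complex.Re v'.
  have := le_lt_trans (le_Re_modulus (v' - v)) vv.
  by rewrite cReD cReN ltr_norml => /andP[h _]; lra.
set q := sqrtc v'; have rq := Re_sqrtc_gt0 v'0; rewrite -/q in rq.
have vE : v = p ^+ 2 by rewrite sqr_sqrtc.
have v'E : v' = q ^+ 2 by rewrite sqr_sqrtc.
have pq : rho <= modulus (q + p).
  apply: le_trans (le_Re_modulus _); rewrite cReD ger0_norm ?addr_ge0 ?(ltW rq) ?(ltW rp) //.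
  by rewrite -/rho lerDr ltW.
have pq0 : 0 < modulus (q + p) by exact: lt_le_trans pq.
have -> : q - p - (2 * p)^-1 * (v' - v) = - (q - p) ^+ 2 / (2 * p).
  by rewrite vE v'E; field.
have vm : modulus (v' - v) = modulus (q - p) * modulus (q + p).
  by rewrite -modulusM vE v'E; congr modulus; ring.
rewrite modulusM modulusN modulusX modulusV modulusM.
have -> : modulus (2 : C) = 2 by rewrite -(cplx_nat R 2) modulus_cplx ger0_norm.
rewrite ler_pdivrMr ?mulr_gt0 // expr2.
have qp : modulus (q - p) <= e * rho * (2 * modulus p).
  rewrite -(ler_pM2r rp); apply: (@le_trans _ _ (modulus (v' - v))).
    by rewrite vm ler_wpM2l // modulus_ge0.
  by rewrite (le_trans (ltW ve)) // le_eqVlt; apply/orP; left; apply/eqP; ring.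
apply: (@le_trans _ _ (modulus (q - p) * (e * rho * (2 * modulus p)))).
  by rewrite ler_wpM2l // modulus_ge0.
have -> : modulus (q - p) * (e * rho * (2 * modulus p)) =
  e * (modulus (q - p) * rho) * (2 * modulus p) by ring.
rewrite ler_wpM2r ?mulr_ge0 ?modulus_ge0 // ler_wpM2l ?(ltW e0) // vm.
by rewrite ler_wpM2l // modulus_ge0.
Qed.

(** Division by z moves the base point to 1, away from the cut of [sqrtc], wherever z lies. *)
Lemma sqrt_branch_id z : z != 0 -> exists s : C -> C, sqrt_branch id s z.
Proof.
move=> z0; exists (fun w => sqrtc z * sqrtc (w / z)).
apply/nbhs_modulusP; exists (modulus z); first by rewrite modulus_gt0.
move=> w wz; split; last first.
  by rewrite exprMn !sqr_sqrtc mulrC divfK.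
have wz0 : 0 < complex.Re (w / z).
  have h : modulus (w / z - 1) < 1.
    have -> : w / z - 1 = (w - z) / z by field.
    by rewrite modulusM modulusV ltr_pdivrMr ?modulus_gt0 // mul1r.
  have := le_lt_trans (le_Re_modulus _) h.
  by rewrite cReD cReN ltr_norml /= => /andP[h1 _]; lra.
have [] // := cderivM (cderiv_cst (sqrtc z) w)
  (cderiv_comp (f := @sqrtc R : C -> C) (g := fun w => w / z)
    (derivableP (derivable_sqrtc wz0))
    (cderivM (cderiv_id w) (cderiv_cst z^-1 w))).
Qed.

Lemma sqrt_branch_weight (l : R) (k : C) z : z != 0 ->
  exists r : C -> C, sqrt_branch (weight l (fun=> k)) r z.
Proof.
move=> z0; exists (fun w => sqrtc k * cexp (cplx l * (w + w^-1) / 4)).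
apply/nbhs_modulusP; exists (modulus z); first by rewrite modulus_gt0.
move=> w wz; have w0 : w != 0.
  by apply: contraTneq wz => ->; rewrite sub0r modulusN ltxx.
split; last first.
  rewrite exprMn sqr_sqrtc mulrC expr2 -cexpD /weight; congr (cexp _ * _).
  by field.
pose h (w : C) := cplx l * (w + w^-1) / 4.
have hd := cderivM (cderivM (cderiv_cst (cplx l) w)
  (cderivD (cderiv_id w) (cderivV w0 (cderiv_id w)))) (cderiv_cst 4^-1 w).
by have [] := cderivM (cderiv_cst (sqrtc k) w)
  (cderiv_comp (g := h) (is_derive_cexp (h w)) hd).
Qed.

Lemma near_off_circle z : z != 0 -> modulus z != 1 ->
  \forall w \near z, w != 0 /\ modulus w != 1.
Proof.
move=> z0 z1; apply/nbhs_modulusP.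
exists (Num.min (modulus z) `|1 - modulus z|).
  by rewrite lt_min modulus_gt0 z0 normr_gt0 subr_eq0 eq_sym.
move=> w; rewrite lt_min => /andP[wz w1]; split.
  by apply: contraTneq wz => ->; rewrite sub0r modulusN ltxx.
apply: contraTneq w1 => w1; rewrite -leNgt ler_norml.
have h1 := le_modulus_dist w z; have h2 := le_modulus_dist z w.
rewrite w1 in h1 h2; rewrite modulusB in h2.
by rewrite h1 andbT lerNl opprB.
Qed.

Lemma sqrt_branch_neq0 f s z : f z != 0 -> sqrt_branch f s z ->
  s z != 0 /\ s z ^+ 2 = f z.
Proof.
move=> fz /nbhs_singleton[_ sE]; split=> //.
by apply: contraNneq fz => s0; rewrite -sE s0 expr0n.
Qed.

(** Differentiate s^2 = f near z. *)
Lemma cderiv_sqrt_branch f s z d : f z != 0 -> is_derive z 1 f d ->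
  sqrt_branch f s z -> is_derive z 1 s (d / (2 * s z)).
Proof.
move=> fz [fd fE] sb; have [s0 _] := sqrt_branch_neq0 fz sb.
have [sd _] := nbhs_singleton sb.
have s2 := cderivX 2 (derivableP sd).
have near_sq : \near z, s z ^+ 2 = f z by apply: filterS sb => w [].
have [_ fE'] := near_eq_is_derive near_sq s2.
rewrite -fE fE' /=; apply: is_derive_eq (derivableP sd) _.
by rewrite expr1; field.
Qed.

End Branches.

(** * Rationality of the structure matrix and its value at the pole *)

Section StructureMatrix.
Variables (R : realType) (l : R) (k : C_of R).
Local Notation C := (C_of R).
Let nu : C -> C := weight l (fun=> k).
Variables (Phi : nat -> {poly C}) (kappa : nat -> R) (n : nat).
Hypothesis OPUC : is_monic_OPUC nu Phi kappa.

(** The index of the structure matrix is n + 1 throughout the section, so its predecessor is n. The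
    pairs ([p1], [g1]) and ([p2], [g2]) are the rows of Y_(n+1). *)
Let K := cauchy_mean (kernel_weight l k n.+1).
Let p1 : {poly C} := Phi n.+1.
Let p2 : {poly C} := (- bcoef kappa n) *: star_poly n (Phi n).
Let g1 := G_fun nu Phi n.+1.
Let g2 (z : C) : C := - bcoef kappa n * Gstar_pred nu Phi n.+1 z.

Let sizePhi j : size (Phi j) = j.+1.
Proof. by have [/(_ j)[]] := OPUC. Qed.

Lemma det_Y_polynomial (r1 r2 : {poly C}) :
  (forall z, modulus z != 1 -> g1 z = p1.[z] * K z + r1.[z]) ->
  (forall z, modulus z != 1 -> g2 z = p2.[z] * K z + r2.[z]) ->
  p1 * r2 - r1 * p2 = 1.
Proof.
move=> g1E g2E; apply/eqP; rewrite -subr_eq0; apply/eqP.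
set b := bcoef kappa n.
have b0 : b != 0 := bcoef_neq0 OPUC n.
have [A1 A10 A1P] := G_fun_decay OPUC n.+1.
have [A2 A20 A2P] := Gstar_pred_decay OPUC n.
have sz1 : (size (p1 - 'X^(n.+1) : {poly C})%R <= n.+1)%N.
  by have [/(_ n.+1)[pm ps] _ _] := OPUC; exact: size_monic_subXn.
have [A3 A30 A3P] := poly_growth sz1.
have [A4 A40 A4P] := poly_growth (eq_leq (sizePhi n.+1)).
have sz2 : (size p2 <= n.+2)%N.
  rewrite (leq_trans (size_scale_leq _ _)) //.
  exact: leq_trans (size_star_poly _ _) _.
have [A5 A50 A5P] := poly_growth sz2.
apply: (@poly_decay_eq0 _ _ (A3 + A4 * (modulus b * A2) + A5 * A1)) => z z2.
have z_gt0 : 0 < modulus z by rewrite (lt_le_trans _ z2).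
have z0 : z != 0 by rewrite -modulus_gt0.
have z1 : modulus z != 1 by rewrite gt_eqF // (lt_le_trans _ z2) // ltr1n.
have z1' : 1 <= modulus z by rewrite (le_trans _ z2) // ler1n.
have zn0 : z ^+ n.+1 != 0 by rewrite expf_neq0.
have zn_gt0 : 0 < modulus z ^+ n.+1 by rewrite exprn_gt0.
have hE (p q r s : {poly C}) w :
  (p * q - r * s - 1).[w] = p.[w] * q.[w] - r.[w] * s.[w] - 1 by rewrite !hornerE.
have hE1 : (p1 - 'X^(n.+1)).[z] = p1.[z] - z ^+ n.+1 by rewrite hornerD hornerN hornerXn.
have := A1P z z2; have := A2P z z2; rewrite -/b.
set E2 := _ + _; set E1 := z ^+ _ * _ => E2le E1le.
(* The 1 is cancelled by the limits of p1 / z^(n+1) and of -b z^(n+1) [Gstar_pred], both equal to 1;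
   each of the three terms left is O(1 / |z|). *)
have -> : (p1 * r2 - r1 * p2 - 1).[z] = (p1 - 'X^(n.+1)).[z] / z ^+ n.+1 -
    p1.[z] / z ^+ n.+1 * (b * E2) - p2.[z] / z ^+ n.+1 * E1.
  have -> : (p1 * r2 - r1 * p2 - 1).[z] = p1.[z] * g2 z - p2.[z] * g1 z - 1.
    by rewrite hE g1E // g2E //; ring.
  rewrite hE1 /E1 /E2 /g1 /g2 /nu -/b.
  move: (G_fun _ _ _ _) (Gstar_pred _ _ _ _) (p1.[z]) (p2.[z]) => G Gs P Q.
  by field; rewrite zn0 b0.
have div_le (p : C) (A : R) : modulus p <= A * modulus z ^+ n.+1 ->
    modulus (p / z ^+ n.+1) <= A.
  by move=> h; rewrite modulusM modulusV modulusX ler_pdivrMr.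
rewrite !mulrDl (le_trans (le_modulusB _ _)) // lerD //; last first.
  rewrite modulusM -mulrA ler_pM ?modulus_ge0 //; first by rewrite div_le ?A5P.
rewrite (le_trans (le_modulusB _ _)) // lerD //.
  rewrite modulusM modulusV modulusX ler_pdivrMr // -mulrA.
  have -> : (modulus z)^-1 * modulus z ^+ n.+1 = modulus z ^+ n.
    by rewrite exprS mulKf // gt_eqF.
  exact: A3P.
rewrite modulusM -mulrA ler_pM ?modulus_ge0 //; first by rewrite div_le ?A4P.
by rewrite modulusM -mulrA ler_pM ?modulus_ge0.
Qed.

(** The upper diagonal entry of z^2 C' C^-1; the lower one is its opposite. *)
Let S : {poly C} := 2^-1 *: weight_poly l n.+1.

Let hornerS z : S.[z] = 2^-1 * (weight_poly l n.+1).[z].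
Proof. by rewrite /S hornerZ. Qed.

(** The row (p, g) of Y becomes (z^2 p' + S p, z^2 g' - S g) in z^2 Z' C^-1. As z^2 K' contributes 2
    S K, the coefficient of K in the second entry is again z^2 p' + S p, and B can be factored
    out. *)
Lemma cderiv_row (p r e : {poly C}) (g : C -> C) z d : modulus z != 1 ->
  (forall w, modulus w != 1 -> g w = p.[w] * K w + r.[w]) ->
  is_derive z 1 K d ->
  z ^+ 2 * d = (weight_poly l n.+1).[z] * K z + e.[z] ->
  exists2 dg, is_derive z 1 g dg &
    z ^+ 2 * dg - S.[z] * g z =
    ('X^2 * p^`() + S * p).[z] * K z + ('X^2 * r^`() - S * r + p * e).[z].
Proof.
move=> z1 gE Kd Kode.
exists (p^`().[z] * K z + p.[z] * d + r^`().[z]).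
  apply: near_eq_is_derive (cderivD (cderivM (cderiv_horner p z) Kd) (cderiv_horner r z)).
  apply/nbhs_modulusP; exists `|1 - modulus z|.
    by rewrite normr_gt0 subr_eq0 eq_sym.
  move=> w wz; rewrite gE //; apply: contraTneq wz => w1.
  have h1 := le_modulus_dist w z; have h2 := le_modulus_dist z w.
  rewrite w1 in h1 h2; rewrite modulusB in h2.
  by rewrite -leNgt ler_norml h1 andbT lerNl opprB.
have hE (s1 s2 : {poly C}) : ('X^2 * s1 + s2).[z] = z ^+ 2 * s1.[z] + s2.[z].
  by rewrite hornerD hornerM hornerXn.
rewrite hE [in RHS]addrAC -addrA hE !hornerD hornerN !hornerM gE //.
have -> : z ^+ 2 * (p^`().[z] * K z + p.[z] * d + r^`().[z]) =
  z ^+ 2 * p^`().[z] * K z + p.[z] * (z ^+ 2 * d) + z ^+ 2 * r^`().[z] by ring.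
by rewrite Kode !hornerS; field.
Qed.

(** The logarithmic derivatives depend only on the squares s^2 = z and r^2 = nu, hence not on the
    branches. *)
Lemma cderiv_factors (s r : C -> C) z : z != 0 -> nu z != 0 ->
  sqrt_branch id s z -> sqrt_branch nu r z ->
  is_derive z 1 (fun w => s w ^- n.+1 * r w) (z ^- 2 * S.[z] * (s z ^- n.+1 * r z)) /\
  is_derive z 1 (fun w => s w ^+ n.+1 * (r w)^-1)
    (- (z ^- 2 * S.[z]) * (s z ^+ n.+1 * (r z)^-1)).
Proof.
move=> z0 nz sb rb.
have [s0 sE] := sqrt_branch_neq0 (f := id) z0 sb; have [r0 rE] := sqrt_branch_neq0 nz rb.
have sd := cderiv_sqrt_branch (f := id) z0 (cderiv_id z) sb.
have rd := cderiv_sqrt_branch nz (cderiv_weight l k z0) rb.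
have sn0 : s z ^+ n.+1 != 0 by rewrite expf_neq0.
have sn := cderivX n.+1 sd.
have Sz : S.[z] = cplx l / 4 * (z ^+ 2 - 1) - n.+1%:R / 2 * z.
  by rewrite hornerS horner_weight_poly; field.
have nuE : nu z = r z ^+ 2 by [].
split.
  apply: is_derive_eq (cderivM (cderivV (f := fun w => s w ^+ n.+1) sn0 sn) rd) _.
  rewrite Sz /= -/nu nuE; move: (n.+1%:R) (s z) (r z) s0 r0 sE => N x y x0 y0 /= <-.
  rewrite (exprS x n); move: (x ^+ n) (expf_neq0 n x0) => X X0.
  by field; rewrite x0 y0 X0.
apply: is_derive_eq (cderivM sn (cderivV r0 rd)) _.
rewrite Sz /= -/nu nuE; move: (n.+1%:R) (s z) (r z) s0 r0 sE => N x y x0 y0 /= <-.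
rewrite (exprS x n); move: (x ^+ n) => X.
by field; rewrite x0 y0.
Qed.

Hypotheses (l_gt0 : 0 < l) (k0 : k != 0).

Lemma weight_neq0 z : nu z != 0.
Proof. by rewrite /nu /weight mulf_neq0 // cexp_neq0. Qed.

(** [N] holds the entries of z^2 M. Choosing it before z makes the formula common to the inside and
    the outside of T. *)
Lemma structure_matrix_rational : exists N : {poly C} * {poly C} * ({poly C} * {poly C}),
  let M z := z ^- 2 *: mx2 N.1.1.[z] N.1.2.[z] N.2.1.[z] N.2.2.[z] in
  (forall z, z != 0 -> modulus z != 1 ->
    is_structure_matrix nu Phi kappa n.+1 z (M z)) /\
  mx2 N.1.1.[0] N.1.2.[0] N.2.1.[0] N.2.2.[0] != 0.
Proof.
have vc := cpath_kernel_weight l k n.+1.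
have [r1 r1P] := cauchy_poly p1 vc.
have g1E z : modulus z != 1 -> g1 z = p1.[z] * K z + r1.[z].
  by move=> z1; rewrite -r1P // /g1 G_funE.
have [r2 r2P] := cauchy_poly p2 vc.
have g2E z : modulus z != 1 -> g2 z = p2.[z] * K z + r2.[z].
  move=> z1; rewrite -r2P // /g2 (Gstar_predE OPUC) // -cauchyZ //; last first.
    exact: cpathM (cpath_horner _ (cpath_expi R)) vc.
  by apply: eq_cauchy => x; rewrite /p2 hornerZ mulrA.
have det1 := det_Y_polynomial g1E g2E.
have [e eP] := cauchy_kernel_ode l k n.+1.
(* [q p] and [h p r] form the row of Q that belongs to the row (p, r) of P. *)
pose q (p : {poly C}) : {poly C} := 'X^2 * p^`() + S * p.
pose h (p r : {poly C}) : {poly C} := 'X^2 * r^`() - S * r + p * e.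
(* N = Q adj(P), with adj(P) = [r2 -r1; -p2 p1]. *)
pose N11 := q p1 * r2 - h p1 r1 * p2; pose N12 := h p1 r1 * p1 - q p1 * r1.
pose N21 := q p2 * r2 - h p2 r2 * p2; pose N22 := h p2 r2 * p1 - q p2 * r1.
(* N P = Q entry by entry, because det P = 1. *)
have row1q : N11 * p1 + N12 * p2 = q p1.
  by rewrite -[RHS]mulr1 -det1 /N11 /N12; ring.
have row1h : N11 * r1 + N12 * r2 = h p1 r1.
  by rewrite -[RHS]mulr1 -det1 /N11 /N12; ring.
have row2q : N21 * p1 + N22 * p2 = q p2.
  by rewrite -[RHS]mulr1 -det1 /N21 /N22; ring.
have row2h : N21 * r1 + N22 * r2 = h p2 r2.
  by rewrite -[RHS]mulr1 -det1 /N21 /N22; ring.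
exists ((N11, N12), (N21, N22)) => M; split; last first.
  apply/eqP => /matrixP N0; move: (N0 0 0) (N0 0 1) (N0 1 0) (N0 1 1).
  rewrite !mxE /= => e11 e12 e21 e22.
  (* S(0) = -l/4 is nonzero. So N(0) = 0 forces p1(0) = p2(0) = 0 through N P = Q, against det P =
     1. *)
  have q0 (p : {poly C}) : (q p).[0] = 0 -> p.[0] = 0.
    rewrite /q hornerD hornerM hornerXn expr0n mul0r add0r hornerM hornerS horner_weight_poly.
    rewrite expr0n mulr0 subr0 sub0r => /eqP; rewrite !mulf_eq0 invr_eq0 pnatr_eq0 /=.
    by rewrite oppr_eq0 oner_eq0 cplx_eq0 gt_eqF //= => /eqP.
  have p10 : p1.[0] = 0.
    by apply: q0; rewrite -row1q hornerD !hornerM e11 e12 !mul0r addr0.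
  have p20 : p2.[0] = 0.
    by apply: q0; rewrite -row2q hornerD !hornerM e21 e22 !mul0r addr0.
  have := congr1 (horner^~ 0) det1.
  rewrite hornerD hornerN !hornerM p10 p20 mul0r mulr0 subr0 hornerC => /eqP.
  by rewrite eq_sym oner_eq0.
move=> z z0 z1; have nz := weight_neq0 z; split.
  have [s sb] := sqrt_branch_id z0; have [r rb] := sqrt_branch_weight l k z0.
  by exists s, r.
move=> s r sb rb Z.
have [s0 sE] := sqrt_branch_neq0 (f := id) z0 sb; have [r0 rE] := sqrt_branch_neq0 nz rb.
have [ud vd] := cderiv_factors z0 nz sb rb.
set u := (fun w => s w ^- n.+1 * r w) in ud; set v := (fun w => s w ^+ n.+1 * (r w)^-1) in vd.
set a := z ^- 2 * S.[z] in ud vd.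
have [d Kd Kode] := eP z z1.
have [dg1 g1d g1ode] := cderiv_row z1 g1E Kd Kode.
have [dg2 g2d g2ode] := cderiv_row z1 g2E Kd Kode.
have uv : u z * v z = 1 by rewrite /u /v; field; rewrite r0 expf_neq0.
have ZE w : w != 0 -> Z w = mx2 (p1.[w] * u w) (g1 w * v w) (p2.[w] * u w) (g2 w * v w).
  move=> w0; rewrite /Z /Z_mx /Y_mx /C_mx mulmx_mx2 !mulr0 !addr0 !add0r.
  rewrite -horner_star_poly ?sizePhi //=.
  by rewrite /p2 hornerZ.
have Zd := is_derive_mx2 (cderivM (cderiv_horner p1 z) ud) (cderivM g1d vd)
  (cderivM (cderiv_horner p2 z) ud) (cderivM g2d vd).
(* This is Z' = M Z: once Q is replaced by N P, the values of K and of the factors [u], [v] behave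
   as formal variables. *)
have {}Zd : is_derive z 1 Z (M z *m Z z).
  have nearZ : \forall w \near z, mx2 (p1.[w] * u w) (g1 w * v w) (p2.[w] * u w) (g2 w * v w) = Z w.
    by apply: filterS (near_off_circle z0 z1) => w [w0 _]; rewrite ZE.
  apply: is_derive_eq (near_eq_is_derive nearZ Zd) _.
  rewrite (ZE z z0) /M /= scale_mx2 mulmx_mx2.
  have z20 : z ^+ 2 != 0 by rewrite expf_neq0.
  have Q (p : {poly C}) : p^`().[z] * u z + p.[z] * (a * u z) = z ^- 2 * (q p).[z] * u z.
    rewrite /q hornerD hornerM hornerXn hornerM /a; field; exact: z0.
  have G (g : C) (dg X : C) : z ^+ 2 * dg - S.[z] * g = X ->
      dg * v z + g * (- a * v z) = z ^- 2 * X * v z.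
    by move=> <-; rewrite /a; field; exact: z0.
  rewrite !Q (G _ _ _ g1ode) (G _ _ _ g2ode) -/(q _) -/(q _) -/(h _ _) -/(h _ _).
  rewrite -row1q -row1h -row2q -row2h g1E // g2E //.
  have hE (s1 t1 s2 t2 : {poly C}) :
      (s1 * t1 + s2 * t2).[z] = s1.[z] * t1.[z] + s2.[z] * t2.[z].
    by rewrite hornerD !hornerM.
  rewrite !hE.
  move: N11.[z] N12.[z] N21.[z] N22.[z] p1.[z] p2.[z] r1.[z] r2.[z] (K z) (u z) (v z).
  by move=> *; congr mx2; ring.
have Zu : Z z \in unitmx.
  rewrite (ZE z z0); apply: unitmx_mx2.
  have := congr1 (horner^~ z) det1; rewrite hornerD hornerN !hornerM hornerC => det1z.
  have -> : p1.[z] * u z * (g2 z * v z) - g1 z * v z * (p2.[z] * u z) =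
      (p1.[z] * r2.[z] - r1.[z] * p2.[z]) * (u z * v z).
    by rewrite g1E // g2E //; ring.
  by rewrite det1z uv mulr1.
have [Zd1 ZdE] := Zd.
by split; [exact: Zd1|exact: Zu|rewrite derive1E ZdE mulmxK].
Qed.

End StructureMatrix.

(** On T the inverse of z is its conjugate, so the exponential factor is e^(l Re z), a positive
    real; a positive weight therefore forces H to be real on T. *)
Lemma entire_real_weight_constant (R : realType) (l : R) (H : C_of R -> C_of R) :
  entire H -> (forall z : C_of R, on_circle z -> 0 < weight l H z) ->
  H = fun=> H 0.
Proof.
move=> Hd w0; apply: funext; apply: entire_real_on_circle Hd _ => z z1.
have conj_cplx (x : R) : (cplx x)^* = cplx x :> C_of R by exact: conjc_real.
have zV : z^-1 = z^*.
  by rewrite invc_norm normc_modulus z1 cplx1 expr1n invr1 mul1r.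
have [x _] : exists2 x : R, 0 < x & weight l H z = cplx x.
  by apply/gt0_cplx/w0; rewrite /on_circle normc_modulus z1.
rewrite /weight.
have -> : cplx l * (z + z^-1) / 2 = cplx (l * complex.Re z) + 'i%C * cplx 0.
  have zzJ : z + z^* = 2 * cplx (complex.Re z) := addcJ z.
  by rewrite zV zzJ cplx0 mulr0 addr0 cplxM; field.
rewrite cexp_line /expi cos0 sin0 mulr1 => HE.
have e0 : cplx (expR (l * complex.Re z)) != 0 :> C_of R by rewrite cplx_eq0 gt_eqF // expR_gt0.
apply: (mulfI e0); rewrite HE -{1}(conj_cplx (expR _)) -rmorphM /= HE.
exact: conj_cplx.
Qed.

Theorem proposition4p1 (R : realType) (l : R) (H : C_of R -> C_of R)
    (Phi : nat -> {poly C_of R}) (kappa : nat -> R) :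
  0 < l ->
  entire H ->
  (forall z : C_of R, on_circle z -> 0 < weight l H z) ->
  is_monic_OPUC (weight l H) Phi kappa ->
  forall n : nat, (1 <= n)%N ->
  exists M : C_of R -> 'M[C_of R]_2,
    [/\ forall z : C_of R, z != 0 -> ~ on_circle z ->
          is_structure_matrix (weight l H) Phi kappa n z (M z),
        forall z : C_of R, z != 0 -> derivable M z 1
      & pole_order2_at0 M].
Proof.
move=> l0 Hd w0; have HE := entire_real_weight_constant Hd w0.
have k0 : H 0 != 0.
  have := w0 1 (normr1 _); rewrite /weight HE.
  by apply: contraTneq => ->; rewrite mulr0 ltxx.
rewrite HE => OPUC [//|n] _.
have [N [Ms N0]] := structure_matrix_rational n OPUC l0 k0.
(* The same formula makes sense on T, where it defines the extension. *)
exists (fun z => z ^- 2 *: mx2 N.1.1.[z] N.1.2.[z] N.2.1.[z] N.2.2.[z]); split.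
- move=> z z0 z1; apply: Ms => //; apply/eqP => z1'; apply: z1.
  by rewrite /on_circle normc_modulus z1'.
- move=> z z0; have z20 : z ^+ 2 != 0 by rewrite expf_neq0.
  under eq_fun do rewrite scale_mx2.
  have zd := cderivV (f := fun w => w ^+ 2) z20 (cderivX 2 (cderiv_id z)).
  have entry (p : {poly C_of R}) := cderivM zd (cderiv_horner p z).
  by have [] := is_derive_mx2 (entry N.1.1) (entry N.1.2) (entry N.2.1) (entry N.2.2).
- exists (mx2 N.1.1.[0] N.1.2.[0] N.2.1.[0] N.2.2.[0]) => //.
  have pc (p : {poly C_of R}) : p.[z] @[z --> (0 : C_of R)^'] --> p.[0].
    apply: cvg_trans (is_derive_continuous (cderiv_horner p 0)).
    by apply: cvg_app; exact: cvg_within.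
  have Nc := cvg_mx2 (pc N.1.1) (pc N.1.2) (pc N.2.1) (pc N.2.2).
  apply: (cvg_trans _ (Nc (dnbhs_filter _))).
  apply: near_eq_cvg; apply/dnbhs_modulusP; exists 1 => // z _ z0.
  by rewrite scalerA mulfV ?scale1r // expf_neq0.
Qed.
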